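(* Let $K\in\mathcal W_{\mathcal Q}$. There is $b_0=b_0(K)$ such that for every fixed real $b\ge b_0$ and every finite positive Borel measure $\mu$ on $\mathbb D$, $$C^{(b)}_{K,\mathcal R}(\mu)\asymp D^{(b)}_{K,\mathcal R}(\mu),$$ with comparison constants independent of $\mu$.
   Context: Notation: $\mathbb D$ is the open unit disc, $\mathbb T=\partial\mathbb D$, $dA=\frac1\pi dx\,dy$. For two quantities, $A\asymp B$ means $A\le CB$ and $B\le CA$ for some constant $C>0$ (in particular one is infinite iff the other is). Class $\mathcal W_{\mathcal Q}$: all non-decreasing, right-continuous $K:[0,\infty)\to[0,\infty)$ such that (K1) $K(0)=0$ and $K(t)>0$ for $t>0$; (K2) $\int_0^1K(\log\frac1r)\,2r\,dr<\infty$; (K3) there is $\sigma>0$ with $\int_0^1\frac{\varphi_K(s)}{s}ds<\infty$ and $\int_1^\infty\frac{\varphi_K(s)}{s^{1+\sigma}}ds<\infty$, where $\varphi_K(s)=\sup_{0<t\le1}\frac{K(st)}{K(t)}$; (K4) there is $C_K\ge1$ with $K(2t)\le C_KK(t)$ for all $t\in[0,1/2]$. Carleson boxes: for an arc $I\subseteq\mathbb T$, $|I|$ is its normalized arclength ($|\mathbb T|=1$) and $Q_I=\{re^{i\theta}\in\mathbb D:e^{i\theta}\in I,\ 1-|I|\le r<1\}$, $Q_{\mathbb T}=\mathbb D$. Polar dyadic resolution $\mathcal R=\{\mathcal R_N\}_{N\ge0}$: $\mathcal R_N=\{R_{N,j,k}:0\le j,k\le2^N-1\}$, $R_{N,j,k}=\{re^{i\theta}:\frac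 j{2^N}\le r^2<\frac{j+1}{2^N},\ \frac{2\pi k}{2^N}\le\theta<\frac{2\pi(k+1)}{2^N}\}$. Packets: $dA_b(w)=(b+1)(1-|w|^2)^b\,dA(w)$, $L_b(z,w)=\int_0^z\frac{d\xi}{(1-\xi\bar w)^{b+2}}$ (principal branch), and $\Psi^{(b)}_R(z)=\int_RL_b(z,w)\,dA_b(w)$ for $R\in\mathcal R_N$. Packet matrix: $\Gamma^{(b)}_{\mu,N}(R_1,R_2)=\int_{\mathbb D}\Psi^{(b)}_{R_1}\overline{\Psi^{(b)}_{R_2}}\,d\mu$, $R_1,R_2\in\mathcal R_N$. Diagonal matrices: $A^{(K)}_{I,N}=\operatorname{diag}\bigl(\int_{R\cap Q_I}K(\frac{1-|z|}{|I|})dA(z):R\in\mathcal R_N\bigr)$ for an arc $I\subseteq\mathbb T$. Discrete norm: for $c=\{c_R\}_{R\in\mathcal R_N}\subset\mathbb C$, $\|c\|_{X_{K,N}}^2=\sup_{I\subseteq\mathbb T}\sum_{R\in\mathcal R_N}|c_R|^2\int_{R\cap Q_I}K(\frac{1-|z|}{|I|})dA(z)$ (supremum over all arcs $I$). Capacities: $C^{(b)}_{K,\mathcal R}(\mu)=\sup_{N\ge0}\sup_{\|c\|_{X_{K,N}}\le1}\int_{\mathbb D}\bigl|\sum_{R\in\mathcal R_N}c_R\Psi^{(b)}_R\bigr|^2d\mu$, and $$D^{(b)}_{K,\mathcal R}(\mu)=\sup_{N\ge0}\inf\Bigl\{\sum_{m=1}^M\lambda_m: M\in\mathbb N,\ \lambda_m\ge0,\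 I_m\subseteq\mathbb T\text{ arcs},\ \Gamma^{(b)}_{\mu,N}\le\sum_{m=1}^M\lambda_mA^{(K)}_{I_m,N}\Bigr\},$$ where $\le$ between Hermitian matrices means that the difference (right minus left) is positive semidefinite. (Up to transposition/conjugation convention, $\int|\sum c_R\Psi_R^{(b)}|^2d\mu$ is the quadratic form of $\Gamma^{(b)}_{\mu,N}$ at $c$.) *)

(* Defs.v *)
From HB Require Import structures.
From mathcomp Require Import all_boot all_order all_algebra.
From mathcomp Require Import all_classical all_reals all_analysis.
From mathcomp Require Import complex.

Set Implicit Arguments.
Unset Strict Implicit.
Unset Printing Implicit Defensive.

Import Order.TTheory GRing.Theory Num.Theory.
Import numFieldNormedType.Exports.
Import ComplexField.Normc.

Local Open Scope classical_set_scope.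
Local Open Scope ring_scope.
Local Open Scope complex_scope.

(* Points of the plane live in R * R, whose product sigma-algebra is the Borel
   one; the norm that the library puts on R * R is the max norm, so moduli are
   always taken after the embedding toC into R[i]. *)
Notation plane R := (measurableTypeR R * measurableTypeR R)%type.

Section Plane.
Context {R : realType}.
Implicit Types (x : plane R) (z w : R[i]).

Definition toC x : R[i] := x.1 +i* x.2.

Definition polar (r t : R) : plane R := (r * cos t, r * sin t).

Definition disc : set (plane R) := [set x | normc (toC x) < 1].

(* Area normalized so that the unit disc has mass 1. *)
Definition area : {measure set (plane R) -> \bar R} :=
  mscale (NngNum (ltW (divr_gt0 ltr01 (@pi_gt0 R))))
    (lebesgue_measure \x lebesgue_measure)%E.

Definition cintegral d (T : measurableType d) (mu : {measure set T -> \bar R})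
    (D : set T) (f : T -> R[i]) : R[i] :=
  Rintegral mu D (fun t => complex.Re (f t)) +i*
  Rintegral mu D (fun t => complex.Im (f t)).

(* Principal argument, with values in ]-pi, pi], of a nonzero z. *)
Definition carg z : R :=
  let a := acos (complex.Re z / normc z) in
  if 0 <= complex.Im z then a else - a.

(* Principal branch of the real power z ^ s. *)
Definition cpow z (s : R) : R[i] :=
  ((normc z) `^ s)%:C * (cos (s * carg z) +i* sin (s * carg z)).

End Plane.

Section Weights.
Context {R : realType}.
Implicit Types K : R -> R.

(* The function phi_K. *)
Definition dilation_sup K (s : R) : \bar R :=
  ereal_sup [set (K (s * t) / K t)%:E | t in `]0, 1]].

(* A weight is given as a function on R of which only the restriction to
   [0, +oo[ matters. *)
Record weight_class K : Prop := WeightClass {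
  weight_nneg : forall t, 0 <= t -> 0 <= K t;
  weight_nondecreasing : forall s t, 0 <= s -> s <= t -> K s <= K t;
  weight_right_continuous : forall t, 0 <= t -> K s @[s --> t^'+] --> K t;
  weight0 : K 0 = 0;
  weight_gt0 : forall t, 0 < t -> 0 < K t;
  weight_log_integral :
    (\int[lebesgue_measure]_(r in `]0%R, 1%R[) (K (ln (1 / r)) * (2 * r))%:E
       < +oo)%E;
  weight_dilation : exists sigma : R, [/\ 0 < sigma,
    (\int[lebesgue_measure]_(s in `]0%R, 1%R[) (dilation_sup K s * (s^-1)%:E)
       < +oo)%E &
    (\int[lebesgue_measure]_(s in `[1%R, +oo[)
       (dilation_sup K s * ((s `^ (1 + sigma))^-1)%:E) < +oo)%E];
  weight_doubling : exists2 CK : R, 1 <= CK &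
    forall t, 0 <= t <= 2^-1 -> K (2 * t) <= CK * K t
}.

End Weights.

(* An arc of the circle of normalized length arc_len, starting at the angle
   arc_start; each endpoint may or may not belong to the arc.  One-point arcs
   are excluded, since |I| occurs as a divisor. *)
Record circle_arc (R : realType) := Arc {
  arc_start : R;
  arc_len : R;
  arc_left : bool;
  arc_right : bool;
  arc_len_gt0 : 0 < arc_len;
  arc_len_le1 : arc_len <= 1
}.

Section Arcs.
Context {R : realType}.
Implicit Types (K : R -> R) (I : circle_arc R).

Definition arc_set I : set (plane R) :=
  [set polar 1 t | t in
    [set` Interval (BSide (arc_left I) (arc_start I))
            (BSide (arc_right I) (arc_start I + 2 * pi * arc_len I))]].

Definition carleson_box I : set (plane R) :=
  [set x | exists r t, [/\ arc_set I (polar 1 t),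
                           1 - arc_len I <= r < 1 & x = polar r t]].

(* The pair (j, k) stands for the cell R_{N,j,k}. *)
Definition cell_index (N : nat) : finType := ('I_(2 ^ N) * 'I_(2 ^ N))%type.

Definition cell N (p : cell_index N) : set (plane R) :=
  [set x | exists r t, [/\ 0 <= r,
     p.1%:R / 2 ^+ N <= r ^+ 2 < p.1.+1%:R / 2 ^+ N,
     2 * pi * p.2%:R / 2 ^+ N <= t < 2 * pi * p.2.+1%:R / 2 ^+ N &
     x = polar r t]].

Definition cell_mass K I N (p : cell_index N) : \bar R :=
  \int[area]_(x in cell p `&` carleson_box I)
    (K ((1 - normc (toC x)) / arc_len I))%:E.

Definition discrete_norm K N (c : cell_index N -> R[i]) : \bar R :=
  sqrte (ereal_sup (range (fun I : circle_arc R =>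
    (\sum_(p : cell_index N) ((normc (c p)) ^+ 2)%:E * cell_mass K I p)%E))).

Definition diag_matrix K I N : 'M[R[i]]_#|cell_index N| :=
  diag_mx (\row_p (fine (cell_mass K I (enum_val p)))%:C).

End Arcs.

Section Packets.
Context {R : realType}.
Implicit Types (K : R -> R) (b : R) (z w : R[i]).

(* The primitive from 0 to z is taken along the segment xi = t z, 0 <= t <= 1;
   the integrand is holomorphic in xi on the unit disc. *)
Definition kernel_primitive b z w : R[i] :=
  cintegral lebesgue_measure `[0, 1]
    (fun t : R => z / cpow (1 - t%:C * z * w^*) (b + 2)).

Definition packet b N (p : cell_index N) z : R[i] :=
  cintegral area (cell p) (fun x =>
    kernel_primitive b z (toC x) *
    ((b + 1) * (1 - (normc (toC x)) ^+ 2) `^ b)%:C).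

Definition packet_matrix b (mu : {measure set (plane R) -> \bar R}) N :
    'M[R[i]]_#|cell_index N| :=
  \matrix_(p, q) cintegral mu disc (fun x =>
    packet b (enum_val p) (toC x) * (packet b (enum_val q) (toC x))^*).

Definition psdmx n (A : 'M[R[i]]_n) : Prop :=
  A \is hermsymmx /\
  forall v : 'rV[R[i]]_n, 0 <= (v *m A *m map_mx Num.conj v^T) 0 0.

Definition loewner_le n (A B : 'M[R[i]]_n) : Prop := psdmx (B - A).

Definition capacityC K b (mu : {measure set (plane R) -> \bar R}) : \bar R :=
  ereal_sup (range (fun N : nat =>
    ereal_sup [set (\int[mu]_(x in disc)
        ((normc (\sum_(p : cell_index N) c p * packet b p (toC x))) ^+ 2)%:E)%E
      | c in [set c : cell_index N -> R[i] | (discrete_norm K c <= 1)%E]])).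

Definition dominating_sum K b (mu : {measure set (plane R) -> \bar R})
    (N : nat) (s : R) : Prop :=
  exists (M : nat) (lambda : 'I_M -> R) (I : 'I_M -> circle_arc R),
    [/\ forall m, 0 <= lambda m,
        loewner_le (packet_matrix b mu N)
          (\sum_(m < M) (lambda m)%:C *: diag_matrix K (I m) N) &
        s = \sum_(m < M) lambda m].

Definition capacityD K b (mu : {measure set (plane R) -> \bar R}) : \bar R :=
  ereal_sup (range (fun N : nat =>
    ereal_inf [set s%:E | s in dominating_sum K b mu N])).

End Packets.

(* Main.v *)
(* Fix N, write q for the quadratic form of the packet matrix and a_I for the
   diagonal of A_I.  A mixture dominating q bounds q on the unit ball of the
   discrete norm, which gives C <= D as soon as the packets are bounded on the
   disc.

   Conversely, let q <= g on the unit ball, and let c maximize q there.  Comparing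
   q c with q at c_p e^(i x_p) to second order gives q (c y) <= sum_p lambda_p y_p^2
   for real y, where sum_p lambda_p = q c <= g; this is a complex form of the little
   Grothendieck inequality.  Hence q v <= 2 sum_p d_p |v_p|^2 with
   d_p = lambda_p / |c_p|^2.  Comparing q c with q at feasible radial perturbations
   of c shows that d is bounded by a multiple of g on every h >= 0 with
   sum_p a_I(p) h_p <= 1 for all I, and a separation argument then bounds d by a
   mixture of the a_I of comparable total weight.  Near-maximizers and near-minimizers
   replace extremizers throughout, so that no compactness is needed. *)

From HB Require Import structures.
Require Import Defs.
From mathcomp Require Import all_boot all_order all_algebra.
From mathcomp Require Import all_classical all_reals all_analysis.
From mathcomp Require Import measurable_realfun complex ring lra.

Import Order.TTheory GRing.Theory Num.Theory.
Import numFieldNormedType.Exports.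
Import ComplexField.Normc.

Local Open Scope classical_set_scope.
Local Open Scope ring_scope.
Local Open Scope complex_scope.

(** * Quadratic forms near a maximum *)

(** The form is convex in [c], while the constraints are linear in [|c_p|^2], so a minimax argument
    does not apply directly. Once the form is bounded by a diagonal one, everything is linear in
    [h_p = |c_p|^2], and what remains is finite-dimensional linear duality. The final constant is 24
    = 2 * 2 * 2 * 3: a factor 2 each for splitting off the coordinates of zero mass, for passing
    from the complex form to real ones, and for the approximate separation, and 3 for moving a
    feasible [h] away from the boundary.

    The analytic obstacle is that packets must stay bounded up to the circle, so that the entries of
    the packet matrix are genuine integrals. The factor [(1 - |w|^2)^b] absorbs the power [b] of the
    kernel and leaves [|1 - t z conj w|^-2], to be integrated in the three real variables [t],
    [Re w], [Im w]. Sharing the exponent equally gives each variable a singularity of order 2/3 < 1,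
    which is integrable uniformly in [z]. *)

Section QuadraticForms.
Context {R : realType} {P : finType}.
Implicit Types (g : P -> P -> R) (x y : P -> R).

Definition bilin g x y : R := \sum_p \sum_q g p q * (x p * y q).

Definition row_sum g (p : P) : R := \sum_q g p q.

Lemma sum_row_sum g : \sum_p row_sum g p = bilin g (fun=> 1) (fun=> 1).
Proof. by apply: eq_bigr => p _; apply: eq_bigr => q _; rewrite !mulr1. Qed.

Lemma bilinZ g (k : R) x :
  bilin g (fun p => k * x p) (fun p => k * x p) = k ^+ 2 * bilin g x x.
Proof.
rewrite mulr_sumr; apply: eq_bigr => p _; rewrite mulr_sumr.
by apply: eq_bigr => q _; ring.
Qed.

Lemma bilin_sub1 g x : (forall p q, g p q = g q p) ->
  bilin g (fun p => x p - 1) (fun p => x p - 1) =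
  bilin g x x - bilin g (fun=> 1) (fun=> 1)
  - 2 * \sum_p row_sum g p * (x p - 1).
Proof.
move=> gC.
have eqC : \sum_p \sum_q g p q * (x q - 1) = \sum_p row_sum g p * (x p - 1).
  rewrite exchange_big; apply: eq_bigr => p _; rewrite mulr_suml.
  by apply: eq_bigr => q _; rewrite gC.
rewrite mulr_natl mulr2n -{1}eqC.
rewrite -big_split -!sumrB; apply: eq_bigr => p _ /=.
rewrite mulr_suml -big_split -!sumrB; apply: eq_bigr => q _ /=; ring.
Qed.

(* Second-order Taylor bound at 1, in terms of [x ^+ 2 - 1] because the
   perturbations of a near-maximizer are prescribed through squared moduli. *)
Lemma bilin_ge1 g x : (forall p q, g p q = g q p) ->
    (forall y, 0 <= bilin g y y) -> (forall p, 0 <= x p) ->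
  bilin g (fun=> 1) (fun=> 1) + \sum_p row_sum g p * (x p ^+ 2 - 1)
  - \sum_p `|row_sum g p| * (x p ^+ 2 - 1) ^+ 2 <= bilin g x x.
Proof.
move=> gC g0 x0; have := g0 (fun p => x p - 1); rewrite bilin_sub1 // => h.
(* Termwise, [y^2 - 1 = 2 (y - 1) + (y - 1)^2], and [(y - 1)^2 <= (y^2 - 1)^2] because
   [y + 1 >= 1]. *)
suff : \sum_p row_sum g p * (x p ^+ 2 - 1)
    - \sum_p `|row_sum g p| * (x p ^+ 2 - 1) ^+ 2
    <= 2 * \sum_p row_sum g p * (x p - 1) by lra.
rewrite mulr_sumr -sumrB; apply: ler_sum => p _.
set l := row_sum g p; have {}x0 := x0 p; move: (x p) x0 => y y0.
have hl := ler_norm l; have l0 := normr_ge0 l.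
have h1 : (y - 1) ^+ 2 <= (y ^+ 2 - 1) ^+ 2.
  have -> : (y ^+ 2 - 1) ^+ 2 = (y - 1) ^+ 2 * (y + 1) ^+ 2 by ring.
  by apply: ler_peMr; [exact: sqr_ge0 | nra].
have -> : l * (y ^+ 2 - 1) = 2 * (l * (y - 1)) + l * (y - 1) ^+ 2 by ring.
have := ler_wpM2l l0 h1.
have := ler_wpM2r (sqr_ge0 (y - 1)) hl.
lra.
Qed.

(** Test the hypothesis at [x = sqrt (1 - s y^2)] and [z = sqrt s * y]. To first order in [s] the
    form loses [s * \sum row_sum * y^2] through [x] and gains [s * bilin g y y] through [z]. The
    second-order error and the slack [s * e / 2] cost [e / 2] each after division by [s]. *)
Lemma near_max_diag_dominates g (s e L : R) y :
    (forall p q, g p q = g q p) -> (forall z, 0 <= bilin g z z) ->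
    0 < s <= 1 -> (forall p, `|row_sum g p| <= L) -> 0 <= e ->
    #|P|%:R * L * s <= e / 2 ->
    (forall x z, (forall p, x p ^+ 2 + z p ^+ 2 = 1) ->
       bilin g x x + bilin g z z <= bilin g (fun=> 1) (fun=> 1) + s * e / 2) ->
  bilin g y y <= \sum_p (row_sum g p + e) * y p ^+ 2.
Proof.
move=> gC g0 /andP[s0 s1] hL e0 hs hmax.
have [m0|m0] := eqVneq (\sum_p y p ^+ 2) 0.
  have y0 p : y p = 0.
    apply/eqP; rewrite -sqrf_eq0; apply/eqP.
    exact: (psumr_eq0P (fun p _ => sqr_ge0 (y p)) m0).
  rewrite /bilin !big1 // => p _; rewrite ?y0 ?expr0n ?mulr0 //.
  by rewrite big1 // => q _; rewrite !y0 !mulr0.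
have {}m0 : 0 < \sum_p y p ^+ 2.
  by rewrite lt0r m0 sumr_ge0 // => p _; exact: sqr_ge0.
wlog m1 : y {m0} / \sum_p y p ^+ 2 = 1 => [hw|].
  set m := \sum_p _ in m0; set k := (Num.sqrt m)^-1.
  have k2 : k ^+ 2 = m^-1 by rewrite exprVn sqr_sqrtr // ltW.
  have := hw (fun p => k * y p); rewrite bilinZ k2.
  under eq_bigr do rewrite exprMn k2; rewrite -mulr_sumr mulVf ?gt_eqF //.
  move=> /(_ erefl).
  rewrite -(ler_pM2l m0) mulrA mulfV ?gt_eqF // mul1r => /le_trans; apply.
  rewrite mulr_sumr; apply: ler_sum => p _; rewrite exprMn k2 le_eqVlt.
  by apply/orP; left; apply/eqP; field; rewrite gt_eqF.
have y1 p : y p ^+ 2 <= 1.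
  rewrite -m1 (bigD1 p) //= lerDl sumr_ge0 // => q _; exact: sqr_ge0.
have sy p : 0 <= 1 - s * y p ^+ 2.
  by have := y1 p; have := sqr_ge0 (y p); nra.
pose r := Num.sqrt s; have r2 : r ^+ 2 = s by rewrite sqr_sqrtr // ltW.
have := hmax (fun p => Num.sqrt (1 - s * y p ^+ 2)) (fun p => r * y p).
have := bilin_ge1 _ (fun p => Num.sqrt (1 - s * y p ^+ 2)) gC g0
  (fun p => sqrtr_ge0 _).
rewrite bilinZ r2; set N := bilin g (fun=> 1) _.
set Q := bilin g (fun p => Num.sqrt _) _ => h1.
have /[swap] /[apply] : forall p,
  Num.sqrt (1 - s * y p ^+ 2) ^+ 2 + (r * y p) ^+ 2 = 1.
  by move=> p; rewrite exprMn r2 sqr_sqrtr // subrK.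
move=> h2; rewrite -(ler_pM2l s0).
have h3 : \sum_p row_sum g p * (Num.sqrt (1 - s * y p ^+ 2) ^+ 2 - 1) =
    - (s * \sum_p row_sum g p * y p ^+ 2).
  rewrite mulr_sumr -sumrN; apply: eq_bigr => p _.
  by rewrite sqr_sqrtr //; ring.
have h4 : \sum_p `|row_sum g p| * (Num.sqrt (1 - s * y p ^+ 2) ^+ 2 - 1) ^+ 2
    <= s * (#|P|%:R * L * s).
  have -> : s * (#|P|%:R * L * s) = \sum_(p : P) L * s ^+ 2.
    by rewrite sumr_const -mulr_natl; ring.
  apply: ler_sum => p _; rewrite sqr_sqrtr //.
  have -> : (1 - s * y p ^+ 2 - 1) ^+ 2 = s ^+ 2 * (y p ^+ 2) ^+ 2 by ring.
  apply: ler_pM => //; first by rewrite mulr_ge0 ?sqr_ge0.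
  by apply: ler_piMr; [exact: sqr_ge0 | rewrite expr_le1 ?sqr_ge0].
have -> : \sum_p (row_sum g p + e) * y p ^+ 2 =
    \sum_p row_sum g p * y p ^+ 2 + e.
  by under eq_bigr do rewrite mulrDl; rewrite big_split -mulr_sumr m1 mulr1.
rewrite h3 in h1; nra.
Qed.

(** The derivative of the form along the perturbation [x^2 = 1 + s * r] is at most the slack. The
    bounds on [r] keep [1 + s * r] nonnegative and the second-order error below [s * e / 2]. *)
Lemma near_max_first_order g (s e L M : R) (r : P -> R) :
    (forall p q, g p q = g q p) -> (forall z, 0 <= bilin g z z) ->
    0 < s <= 1 -> (forall p, `|row_sum g p| <= L) ->
    (forall p, -1 <= r p <= M) -> 1 <= M ->
    #|P|%:R * L * M ^+ 2 * s <= e / 2 ->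
    (forall x, (forall p, x p ^+ 2 = 1 + s * r p) ->
       bilin g x x <= bilin g (fun=> 1) (fun=> 1) + s * e / 2) ->
  \sum_p row_sum g p * r p <= e.
Proof.
move=> gC g0 /andP[s0 s1] hL hr M1 hs hmax.
have sr p : 0 <= 1 + s * r p by have /andP[] := hr p; nra.
have := bilin_ge1 _ (fun p => Num.sqrt (1 + s * r p)) gC g0
  (fun p => sqrtr_ge0 _).
have := hmax (fun p => Num.sqrt (1 + s * r p))
  (fun p => sqr_sqrtr (sr p)).
set N := bilin g (fun=> 1) _; set Q := bilin g _ _.
have -> : \sum_p row_sum g p * (Num.sqrt (1 + s * r p) ^+ 2 - 1) =
    s * \sum_p row_sum g p * r p.
  rewrite mulr_sumr; apply: eq_bigr => p _.
  by rewrite sqr_sqrtr //; ring.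
have h4 : \sum_p `|row_sum g p| * (Num.sqrt (1 + s * r p) ^+ 2 - 1) ^+ 2
    <= s * (#|P|%:R * L * M ^+ 2 * s).
  have -> : s * (#|P|%:R * L * M ^+ 2 * s) =
      \sum_(p : P) L * (s ^+ 2 * M ^+ 2).
    by rewrite sumr_const -mulr_natl; ring.
  apply: ler_sum => p _; rewrite sqr_sqrtr //.
  have -> : (1 + s * r p - 1) ^+ 2 = s ^+ 2 * (r p) ^+ 2 by ring.
  apply: ler_pM => //; first by rewrite mulr_ge0 ?sqr_ge0.
  by apply: ler_wpM2l; [exact: sqr_ge0 | have /andP[] := hr p; nra].
move=> h1 h2; rewrite -(ler_pM2l s0); nra.
Qed.

End QuadraticForms.

(** * Mixtures of weights *)

Section Mixtures.
Context {R : realType} {P : finType} {T : Type}.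
Variable a : T -> P -> R.
Implicit Types (l : seq (R * T)) (d h : P -> R).

Definition feasible h := forall I, \sum_p h p * a I p <= 1.

Definition weights_ge0 l := all (fun u => 0 <= u.1) l.

Definition total_weight l : R := \sum_(u <- l) u.1.

Definition mixture l (p : P) : R := \sum_(u <- l) u.1 * a u.2 p.

Definition scale_weights (k : R) l := [seq (k * u.1, u.2) | u <- l].

Lemma scale_weights_ge0 k l :
  0 <= k -> weights_ge0 l -> weights_ge0 (scale_weights k l).
Proof.
move=> k0; rewrite /weights_ge0 all_map; apply: sub_all => u /= u0.
exact: mulr_ge0.
Qed.

Lemma total_scale_weights k l :
  total_weight (scale_weights k l) = k * total_weight l.
Proof. by rewrite /total_weight big_map mulr_sumr. Qed.

Lemma mixture_scale_weights k l p :
  mixture (scale_weights k l) p = k * mixture l p.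
Proof.
by rewrite /mixture big_map mulr_sumr; apply: eq_bigr => u _; rewrite mulrA.
Qed.

Variable B : R.
Hypothesis a_bound : forall I p, 0 <= a I p <= B.

Lemma mixture_bound l p : weights_ge0 l ->
  0 <= mixture l p <= B * total_weight l.
Proof.
elim: l => [|u l IHl] /=; first by rewrite /mixture /total_weight !big_nil; nra.
move=> /andP[u0 /IHl]; rewrite /mixture /total_weight !big_cons.
by have := a_bound u.2 p; nra.
Qed.

(** Squared distance from [d] to the vectors lying below the mixture: only the deficit counts. *)
Let gap d l : R := \sum_p Num.max 0 (d p - mixture l p) ^+ 2.

(** One Frank-Wolfe step: a fraction [s] of the total weight is moved onto the single index [I]. The
    linear term is the directional derivative of the squared distance. *)
Let gap_step d l (c s : R) I : weights_ge0 l -> total_weight l = c ->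
    0 <= c -> 0 <= s <= 1 ->
  gap d ((s * c, I) :: scale_weights (1 - s) l) <=
  gap d l - 2 * s * (\sum_p Num.max 0 (d p - mixture l p)
                       * (c * a I p - mixture l p))
  + s ^+ 2 * (#|P|%:R * (c * B) ^+ 2).
Proof.
move=> l0 lc c0 /andP[s0 s1].
have -> : s ^+ 2 * (#|P|%:R * (c * B) ^+ 2) =
    \sum_(p : P) s ^+ 2 * (c * B) ^+ 2.
  by rewrite sumr_const -mulr_natl; ring.
rewrite mulr_sumr -sumrB -big_split; apply: ler_sum => p _ /=.
rewrite /mixture big_cons /= -[\sum_(u <- scale_weights _ _) _]/(mixture _ p).
rewrite mixture_scale_weights -[\sum_(u <- l) _]/(mixture l p).
have := mixture_bound _ p l0; rewrite lc; have := a_bound I p.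
move: (mixture l p) (a I p) => t e /andP[e0 eB] /andP[t0 tB].
set w := Num.max 0 (d p - t).
have w0 : 0 <= w by rewrite le_max lexx.
have dw : d p - t <= w by rewrite le_max lexx orbT.
have ce0 : 0 <= c * e by exact: mulr_ge0.
have ceB : c * e <= c * B by exact: ler_wpM2l.
have hd : (c * e - t) ^+ 2 <= (c * B) ^+ 2.
  rewrite -subr_ge0 subr_sqr; apply: mulr_ge0; lra.
have hd2 := ler_wpM2l (sqr_ge0 s) hd.
apply: (@le_trans _ _ ((w - s * (c * e - t)) ^+ 2)); last by nra.
rewrite maxEle; case: ifP => [h|_]; last by rewrite expr0n /= sqr_ge0.
have le_w : d p - (s * c * e + (1 - s) * t) <= w - s * (c * e - t).
  by rewrite -subr_ge0; move: dw; rewrite -subr_ge0; lra.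
by rewrite ler_pXn2r ?nnegrE // (le_trans h).
Qed.

(** Separation by nearest point. At a near-minimizer of [gap], the deficit [w = max 0 (d - m)], with
    [m] the mixture, satisfies [\sum w * c * a I <= \sum w * m + k^2] for all [I]. Hence a multiple
    of [w] is feasible, and the hypothesis on [d] yields [\sum w^2 <= k^2]. As [2 * k <= d p]
    everywhere, the deficit is at most [d p / 2], whence the factor 2. *)
Lemma feasible_dual_mixture (i0 : T) d (c : R) : 0 < c ->
    (forall p, 0 < d p) ->
    (forall h, (forall p, 0 <= h p) -> feasible h -> \sum_p h p * d p <= c) ->
  exists l, [/\ weights_ge0 l, total_weight l = c &
                forall p, d p <= 2 * mixture l p].
Proof.
move=> c0 d0 hd.
have [k k0 kd] : exists2 k, 0 < k & forall p, 2 * k <= d p.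
  have : forall s : seq P, exists2 k, 0 < k & forall p, p \in s -> 2 * k <= d p.
    elim=> [|p s [k k0 kd]]; first by exists 1.
    exists (Num.min k (d p / 2)); first by rewrite lt_min k0 divr_gt0.
    move=> q; rewrite inE => /predU1P[->|/kd].
      have : Num.min k (d p / 2) <= d p / 2 by rewrite ge_min lexx orbT.
      lra.
    have : Num.min k (d p / 2) <= k by rewrite ge_min lexx.
    lra.
  move=> /(_ (enum P))[k k0 kd]; exists k => // p.
  by apply: kd; rewrite mem_enum.
pose beta := #|P|%:R * (c * B) ^+ 2.
have beta0 : 0 <= beta by rewrite mulr_ge0 ?sqr_ge0.
(* A step size at most 1 with [s * beta <= k^2]: the quadratic error of a step and the distance to
   the infimum are then both at most [s * k^2]. *)
pose s := k ^+ 2 / (beta + k ^+ 2).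
have k20 : 0 < k ^+ 2 by rewrite exprn_gt0.
have s0 : 0 < s by rewrite divr_gt0 // ltr_wpDl.
have s1 : s <= 1 by rewrite ler_pdivrMr ?ltr_wpDl // mul1r lerDr.
have sb : s * beta <= k ^+ 2.
  rewrite mulrAC ler_pdivrMr ?ltr_wpDl //; nra.
pose E := [set gap d l | l in [set l | weights_ge0 l /\ total_weight l = c]].
have E0 : E !=set0.
  exists (gap d [:: (c, i0)]), [:: (c, i0)] => //; split.
    by rewrite /weights_ge0 /= ltW.
  by rewrite /total_weight big_seq1.
have Einf : has_inf E.
  split=> //; exists 0 => _ [l _ <-]; apply: sumr_ge0 => p _; exact: sqr_ge0.
have [_ [l [l0 lc] <-] hl] : exists2 x, E x & x < inf E + s * k ^+ 2.
  by apply: inf_adherent => //; rewrite mulr_gt0.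
exists l; split=> // p.
pose w p := Num.max 0 (d p - mixture l p).
have w0 q : 0 <= w q by rewrite /w le_max lexx.
have hw I : \sum_p w p * (c * a I p - mixture l p) <= k ^+ 2.
  have hs : 0 <= s <= 1 by rewrite ltW.
  have := gap_step d _ _ _ I l0 lc (ltW c0) hs.
  rewrite -/beta -/(\sum_p w p * (c * a I p - mixture l p)).
  set l' := _ :: _; set S := \sum_p w p * _.
  have : inf E <= gap d l'.
    apply: ge_inf; first by case: Einf.
    exists l' => //; split.
      rewrite /weights_ge0 /= mulr_ge0 ?ltW //=.
      by apply: scale_weights_ge0 => //; lra.
    rewrite /total_weight big_cons -/(total_weight _) total_scale_weights lc /=.
    ring.
  move=> h1 h2; rewrite -(ler_pM2l s0).
  have := ler_wpM2l (ltW s0) sb; nra.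
pose r := \sum_p w p * mixture l p.
have r0 : 0 <= r.
  by apply: sumr_ge0 => q _; rewrite mulr_ge0 //; case/andP: (mixture_bound l q l0).
have rk : 0 < r + k ^+ 2 by rewrite ltr_wpDl.
have : \sum_p (c / (r + k ^+ 2) * w p) * d p <= c.
  apply: hd => [q|I]; first by rewrite mulr_ge0 // divr_ge0 // ltW.
  rewrite -(ler_pM2l rk) mulr1 mulr_sumr -subr_ge0.
  have := hw I; under eq_bigr do rewrite mulrBr.
  rewrite sumrB -/r -subr_ge0 => /le_trans; apply; rewrite le_eqVlt.
  apply/orP; left; apply/eqP; rewrite opprB addrCA addrA; congr (_ - _).
  by apply: eq_bigr => q _; field; rewrite gt_eqF.
under eq_bigr do rewrite -mulrA; rewrite -mulr_sumr mulrAC ler_pdivrMr //.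
rewrite (ler_pM2l c0) -lerBlDl -sumrB => hk.
suff : w p ^+ 2 <= k ^+ 2.
  rewrite ler_pXn2r ?nnegrE ?(ltW k0) // => wk.
  have : d p - mixture l p <= w p by rewrite /w le_max lexx orbT.
  have := kd p; lra.
apply: le_trans hk; rewrite (bigD1 p) //=.
have eqw q : w q * d q - w q * mixture l q = w q ^+ 2.
  rewrite -mulrBr /w maxEle; case: ifP => _; first by rewrite expr2.
  by rewrite mul0r expr0n.
by rewrite eqw lerDl sumr_ge0 // => q _; rewrite eqw sqr_ge0.
Qed.

End Mixtures.

(** * Hermitian forms *)

Section HermitianForms.
Context {R : realType} {P : finType}.
Implicit Types (G : P -> P -> R[i]) (v c : P -> R[i]) (x y : P -> R).

Lemma normc_sqr (z : R[i]) :
  normc z ^+ 2 = complex.Re z ^+ 2 + complex.Im z ^+ 2.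
Proof. by case: z => u w /=; rewrite sqr_sqrtr // addr_ge0 ?sqr_ge0. Qed.

Lemma normcM_sqr (z w : R[i]) : normc (z * w) ^+ 2 = normc z ^+ 2 * normc w ^+ 2.
Proof. by rewrite normcM exprMn. Qed.

Definition hermitian_form G v : R :=
  \sum_p \sum_q complex.Re (v p * (v q)^* * G p q).

Definition twist c x y (p : P) : R[i] := c p * (x p +i* y p).

Definition twisted_form G c (p q : P) : R := complex.Re (c p * (c q)^* * G p q).

Lemma twisted_form_sym G c : (forall p q, G q p = (G p q)^*) ->
  forall p q, twisted_form G c p q = twisted_form G c q p.
Proof.
move=> GC p q; rewrite /twisted_form (GC p q).
by case: (c p) (c q) (G p q) => [a1 a2] [b1 b2] [g1 g2] /=; ring.
Qed.

(** Changing [y] to [- y] flips the terms mixing [x] and [y]. Adding the two twists removes them and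
    leaves a real symmetric form evaluated at [x] and at [y]. *)
Lemma hermitian_form_twist G c x y :
  hermitian_form G (twist c x y) + hermitian_form G (twist c x (fun p => - y p))
  = 2 * (bilin (twisted_form G c) x x + bilin (twisted_form G c) y y).
Proof.
rewrite /bilin -!big_split mulr_sumr; apply: eq_bigr => p _ /=.
rewrite -!big_split mulr_sumr; apply: eq_bigr => q _ /=.
rewrite /twisted_form /twist.
by case: (c p) (c q) (G p q) => [a1 a2] [b1 b2] [g1 g2] /=; ring.
Qed.

Lemma bilin_twisted G c x :
  bilin (twisted_form G c) x x = hermitian_form G (fun p => c p * (x p)%:C).
Proof.
apply: eq_bigr => p _; apply: eq_bigr => q _; rewrite /twisted_form.
by case: (c p) (c q) (G p q) => [a1 a2] [b1 b2] [g1 g2] /=; ring.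
Qed.

Lemma bilin_twisted1 G c :
  bilin (twisted_form G c) (fun=> 1) (fun=> 1) = hermitian_form G c.
Proof.
by rewrite bilin_twisted; congr hermitian_form; apply/funext => p; rewrite mulr1.
Qed.

Lemma normc_twist_sqr c x y p :
  normc (twist c x y p) ^+ 2 = normc (c p) ^+ 2 * (x p ^+ 2 + y p ^+ 2).
Proof. by rewrite normcM_sqr (normc_sqr (_ +i* _)). Qed.

Lemma twist_div c v : (forall p, c p != 0) ->
  twist c (fun p => complex.Re (v p / c p)) (fun p => complex.Im (v p / c p)) = v.
Proof.
move=> c0; apply/funext => p; rewrite /twist.
have -> : complex.Re (v p / c p) +i* complex.Im (v p / c p) = v p / c p.
  by case: (_ / _).
by rewrite mulrCA mulfV // mulr1.
Qed.

Lemma hermitian_formD_le G u v : (forall w, 0 <= hermitian_form G w) ->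
  hermitian_form G (fun p => u p + v p) <=
  2 * (hermitian_form G u + hermitian_form G v).
Proof.
move=> /(_ (fun p => u p - v p)).
suff -> : hermitian_form G (fun p => u p - v p) =
  2 * (hermitian_form G u + hermitian_form G v)
  - hermitian_form G (fun p => u p + v p) by rewrite subr_ge0.
rewrite /hermitian_form -big_split mulr_sumr -sumrB; apply: eq_bigr => p _ /=.
rewrite -big_split mulr_sumr -sumrB; apply: eq_bigr => q _ /=.
case: (u p) (u q) (v p) (v q) (G p q) => [a1 a2] [b1 b2] [c1 c2] [d1 d2] [e1 e2].
by rewrite /=; ring.
Qed.

Lemma hermitian_formZ G (k : R) v :
  hermitian_form G (fun p => k%:C * v p) = k ^+ 2 * hermitian_form G v.
Proof.
rewrite /hermitian_form mulr_sumr; apply: eq_bigr => p _ /=.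
rewrite mulr_sumr; apply: eq_bigr => q _ /=.
by case: (v p) (v q) (G p q) => [a1 a2] [b1 b2] [g1 g2] /=; ring.
Qed.

End HermitianForms.

(** * Domination of a Hermitian form by a diagonal one *)

Section Domination.
Context {R : realType} {P : finType} {T : Type}.
Variables (a : T -> P -> R) (B : R) (G : P -> P -> R[i]) (gam : R).
Hypothesis a_bound : forall I p, 0 <= a I p <= B.
Hypothesis G_sym : forall p q, G q p = (G p q)^*.
Hypothesis G_ge0 : forall v, 0 <= hermitian_form G v.
Hypothesis gam0 : 0 < gam.
Hypothesis form_le : forall v, feasible a (fun p => normc (v p) ^+ 2) ->
  hermitian_form G v <= gam.

Let feasible_le h h' : feasible a h' -> (forall p, h p <= h' p) -> feasible a h.
Proof.
move=> fh' hh' I; apply: le_trans (fh' I); apply: ler_sum => p _.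
by apply: ler_wpM2r => //; case/andP: (a_bound I p).
Qed.

Let twisted_ge0 c x : 0 <= bilin (twisted_form G c) x x.
Proof. by rewrite bilin_twisted. Qed.

(** Positivity at [1 + delta_p] and [1 - delta_p] gives [2 * |row_sum| <= bilin g 1 1 + g p p]. Both
    terms are values of the form at feasible vectors, the second at [c] restricted to the coordinate
    [p]. *)
Let row_sum_bound c p : feasible a (fun p => normc (c p) ^+ 2) ->
  `|row_sum (twisted_form G c) p| <= gam.
Proof.
move=> fc; set g := twisted_form G c.
have gC := twisted_form_sym G c G_sym.
pose e (s : R) q := 1 + (if q == p then s else 0).
have he s : bilin g (e s) (e s) = bilin g (fun=> 1) (fun=> 1)
    + 2 * s * row_sum g p + s ^+ 2 * g p p.
  have := bilin_sub1 g (e s) gC.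
  have -> : \sum_q row_sum g q * (e s q - 1) = s * row_sum g p.
    rewrite (@big_only1 _ _ _ _ p) // /e ?eqxx; first by ring.
    by move=> q /negbTE -> _; ring.
  have -> : bilin g (fun q => e s q - 1) (fun q => e s q - 1) = s ^+ 2 * g p p.
    rewrite /bilin (@big_only1 _ _ _ _ p) // /e.
      rewrite (@big_only1 _ _ _ _ p) // ?eqxx; first by ring.
      by move=> q /negbTE -> _; ring.
    by move=> q /negbTE -> _; rewrite big1 // => r _; ring.
  lra.
have g11 : bilin g (fun=> 1) (fun=> 1) <= gam.
  by rewrite bilin_twisted1; exact: form_le.
have gpp : g p p <= gam.
  pose u q := if q == p then c p else 0.
  suff -> : g p p = hermitian_form G u.
    apply: form_le; apply: feasible_le fc _ => q; rewrite /u.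
    by case: eqP => [->//|_]; rewrite normc0 expr0n sqr_ge0.
  rewrite /hermitian_form (@big_only1 _ _ _ _ p) // /u.
    rewrite (@big_only1 _ _ _ _ p) // ?eqxx //.
    move=> q /negbTE -> _.
    by case: (c p) (G p q) => [a1 a2] [g1 g2] /=; ring.
  by move=> q /negbTE -> _; rewrite big1 // => r _; rewrite !mul0r.
have := twisted_ge0 c (e 1); have := twisted_ge0 c (e (-1)).
rewrite -/g !he ler_norml => h1 h2; apply/andP; split; lra.
Qed.

(* The values [|c p|^2] of a near-maximizer [c] of the form are kept away from 0
   so that multiplicative perturbations of [c] reach every vector.  Unimodular
   perturbations bound the form by a diagonal one (second order), radial
   perturbations bound that diagonal on the feasible set (first order). *)
Lemma diagonal_domination : (forall p, exists I, 0 < a I p) ->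
  exists d : P -> R, [/\ forall p, 0 < d p,
    forall v, hermitian_form G v <= 2 * \sum_p d p * normc (v p) ^+ 2 &
    forall h, (forall p, 0 <= h p) -> feasible a h ->
      \sum_p h p * d p <= 3 * gam].
Proof.
move=> a_pos.
(* An arc with [a I p > 0] bounds [h p] by [(a I p)^-1]. *)
have [M M0 hM] : exists2 M, 0 < M & forall h, (forall p, 0 <= h p) ->
    feasible a h -> forall p, h p <= M.
  have : forall s : seq P, exists2 M, 0 < M & forall h, (forall p, 0 <= h p) ->
      feasible a h -> forall p, p \in s -> h p <= M.
    elim=> [|p s [M M0 hM]]; first by exists 1.
    have [I aI] := a_pos p.
    exists (M + (a I p)^-1); first by rewrite addr_gt0 ?invr_gt0.
    move=> h h0 fh q; rewrite inE => /predU1P[->|/(hM h h0 fh)].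
      rewrite ler_wpDl ?(ltW M0) // -[leRHS]mul1r ler_pdivlMr //.
      apply: le_trans (fh I); rewrite (bigD1 p) //= lerDl sumr_ge0 // => r _.
      by rewrite mulr_ge0 //; case/andP: (a_bound I r).
    by move=> /le_trans; apply; rewrite lerDl invr_ge0 ltW.
  move=> /(_ (enum P))[M M0 hM]; exists M => // h h0 fh p.
  by apply: hM; rewrite ?mem_enum.
pose n : R := #|P|%:R; have n0 : 0 <= n by rewrite ler0n.
have [kap kap0 hkap] : exists2 kap, 0 < kap & feasible a (fun=> kap).
  exists ((n * `|B| + 1)^-1) => [|I].
    by rewrite invr_gt0 ltr_wpDl // mulr_ge0.
  rewrite -mulr_sumr mulrC ler_pdivrMr ?mul1r; last first.
    by rewrite ltr_wpDl // mulr_ge0.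
  apply: (@le_trans _ _ (\sum_(p : P) `|B|)); last first.
    by rewrite sumr_const -mulr_natl lerDl.
  apply: ler_sum => p _; case/andP: (a_bound I p) => _ /le_trans; apply.
  exact: ler_norm.
(* Half of the feasible constant [kap] serves as a floor: the average of any feasible [h >= 0] with
   [kap] lies in [F]. *)
pose F h := (forall p, kap / 2 <= h p) /\ feasible a h.
(* Bound for the ratio of a vector of [F], at most [M], to [|c p|^2], at least [kap / 2]; the
   summand 1 ensures [1 <= M']. *)
pose M' := 2 * M / kap + 1.
have M'1 : 1 <= M' by rewrite lerDr divr_ge0 // ?mulr_ge0 // ltW.
(* The errors at the end add up to [e + 2 * e * n * M']; this choice makes them at most
   [gam / 2]. *)
pose e := gam / (2 * (1 + 2 * n * M')).
have nM' : 0 <= n * M' by rewrite mulr_ge0 // (le_trans _ M'1).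
have e0 : 0 < e by rewrite divr_gt0 // mulr_gt0 //; lra.
have he : e * (1 + 2 * n * M') = gam / 2.
  by rewrite /e; field; rewrite gt_eqF //; lra.
pose D := 1 + n * gam * M' ^+ 2.
have D1 : 1 <= D by rewrite lerDl mulr_ge0 ?sqr_ge0 // mulr_ge0 // ltW.
have D0 : 0 < D by exact: lt_le_trans D1.
pose s := Num.min 1 (e / 2 / D).
have s0 : 0 < s by rewrite lt_min ltr01 divr_gt0 // divr_gt0.
have s1 : s <= 1 by rewrite ge_min lexx.
have sD : n * gam * M' ^+ 2 * s <= e / 2.
  have : s <= e / 2 / D by rewrite ge_min lexx orbT.
  rewrite ler_pdivlMr // => /(le_trans _); apply.
  by rewrite /D; nra.
pose E := [set hermitian_form G v | v in
  [set v | F (fun p => normc (v p) ^+ 2)]].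
have Esup : has_sup E.
  split; last by exists gam => _ [v [_ fv] <-]; exact: form_le.
  exists (hermitian_form G (fun=> (Num.sqrt kap)%:C)), (fun=> (Num.sqrt kap)%:C) => //.
  have eqk : (fun p : P => normc (Num.sqrt kap)%:C ^+ 2) = fun=> kap.
    by apply/funext => p; rewrite normc_sqr /= expr0n addr0 sqr_sqrtr // ltW.
  by rewrite /mkset eqk; split=> // p; lra.
have [_ [c Fc <-] hc] : exists2 x, E x & sup E - s * e / 2 < x.
  by apply: sup_adherent => //; rewrite divr_gt0 // mulr_gt0.
set g := twisted_form G c.
pose hc2 p := normc (c p) ^+ 2.
have [hck fc] := Fc.
have hc0 p : 0 < hc2 p by apply: lt_le_trans (hck p); rewrite divr_gt0.
(* Both conjugate twists of [c] have the same squared moduli, so both forms are at most [sup E];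
   their average is the real statement. *)
have near_max x y : F (fun p => hc2 p * (x p ^+ 2 + y p ^+ 2)) ->
    bilin g x x + bilin g y y <= bilin g (fun=> 1) (fun=> 1) + s * e / 2.
  move=> Fxy; have hE y' : (forall p, y' p ^+ 2 = y p ^+ 2) ->
      hermitian_form G (twist c x y') <= sup E.
    move=> hy'; apply: ub_le_sup; first by case: Esup.
    exists (twist c x y') => //=.
    have -> : (fun p => normc (twist c x y' p) ^+ 2) =
        fun p => hc2 p * (x p ^+ 2 + y p ^+ 2); last by [].
    by apply/funext => p; rewrite normc_twist_sqr hy'.
  have := hE y (fun=> erefl); have := hE (fun p => - y p) (fun p => sqrrN _).
  have := hermitian_form_twist G c x y; have := bilin_twisted1 G c.
  rewrite -/g; lra.
have gC := twisted_form_sym G c G_sym.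
have hrow p := row_sum_bound c p fc.
have second y : bilin g y y <= \sum_p (row_sum g p + e) * y p ^+ 2.
  apply: (near_max_diag_dominates g s e gam) => //; rewrite ?s0 ?(ltW e0) //.
  - exact: twisted_ge0.
  - apply: le_trans sD; rewrite ler_wpM2r ?(ltW s0) // ler_peMr //.
      by rewrite mulr_ge0 // ltW.
    by rewrite expr_ge1 // (le_trans _ M'1).
  - move=> x z hxz; apply: near_max.
    have -> : (fun p => hc2 p * (x p ^+ 2 + z p ^+ 2)) = hc2; last by [].
    by apply/funext => p; rewrite hxz mulr1.
have row_ge p : 0 <= row_sum g p + e.
  have := second (fun q => (q == p)%:R).
  rewrite [leRHS](@big_only1 _ _ _ _ p) //= ?eqxx ?expr1n ?mulr1.
    by move=> /(le_trans _); apply; exact: twisted_ge0.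
  by move=> q /negbTE -> _; rewrite expr0n mulr0.
have sum_row : \sum_p row_sum g p <= gam.
  by rewrite sum_row_sum bilin_twisted1 form_le.
(* One [e] comes from the second-order comparison; the other makes the weights strictly positive. *)
exists (fun p => (row_sum g p + 2 * e) / hc2 p); split.
- by move=> p; rewrite divr_gt0 //; have := row_ge p; lra.
- move=> v.
  have c0 p : c p != 0.
    by apply/eqP => cp; have := hc0 p; rewrite /hc2 cp normc0 expr0n ltxx.
  pose x p := complex.Re (v p / c p); pose y p := complex.Im (v p / c p).
  have := hermitian_form_twist G c x y.
  have vE : twist c x y = v by exact: twist_div.
  rewrite vE -/g => hv.
  (* The conjugate twist of [v] has nonnegative form; discarding it costs the factor 2. *)
  have := G_ge0 (twist c x (fun p => - y p)); have := second x; have := second y.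
  suff : \sum_p (row_sum g p + e) * x p ^+ 2 + \sum_p (row_sum g p + e) * y p ^+ 2
      <= \sum_p (row_sum g p + 2 * e) / hc2 p * normc (v p) ^+ 2 by lra.
  rewrite -big_split; apply: ler_sum => p _ /=.
  rewrite -vE normc_twist_sqr -/(hc2 p) [leRHS]mulrA divfK ?gt_eqF // -mulrDr.
  by apply: ler_wpM2r; [rewrite addr_ge0 ?sqr_ge0 | lra].
move=> h h0 fh.
(* Since [h <= 2 * h'], the bound [3 * gam / 2] for [h'] suffices. *)
pose h' p := (h p + kap) / 2.
have Fh' : F h'.
  split=> [p|I]; first by rewrite /h'; have := h0 p; lra.
  have := fh I; have := hkap I.
  have -> : \sum_p h' p * a I p =
      (\sum_p h p * a I p + \sum_p kap * a I p) / 2.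
    by rewrite -big_split mulr_suml; apply: eq_bigr => p _; rewrite /h' /=; field.
  lra.
have h'0 p : 0 <= h' p by rewrite /h'; have := h0 p; lra.
have rM p : 0 <= h' p / hc2 p <= M'.
  rewrite divr_ge0 ?(ltW (hc0 p)) //= ler_pdivrMr //.
  apply: (@le_trans _ _ (M' * (kap / 2))); last first.
    by apply: ler_wpM2l (hck p); exact: le_trans M'1.
  have := hM h' h'0 Fh'.2 p.
  have -> : M' * (kap / 2) = M + kap / 2 by rewrite /M'; field; rewrite gt_eqF.
  lra.
have first : \sum_p row_sum g p * (h' p / hc2 p - 1) <= e.
  apply: (near_max_first_order g s e gam M') => //; rewrite ?s0 ?s1 //.
  - exact: twisted_ge0.
  - by move=> p; have := rM p; lra.
  - move=> x hx.
    have := near_max x (fun=> 0).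
    have -> : bilin g (fun=> 0) (fun=> 0) = 0.
      by rewrite /bilin big1 // => p _; rewrite big1 // => q _; rewrite !mulr0.
    rewrite addr0; apply.
    (* The radial perturbation is a convex combination of two members of [F], hence stays in [F]. *)
    have -> : (fun p => hc2 p * (x p ^+ 2 + 0 ^+ 2)) =
        fun p => (1 - s) * hc2 p + s * h' p.
      by apply/funext => p; rewrite hx; field; rewrite gt_eqF.
    split=> [p|I].
      by have := hck p; have := Fh'.1 p; rewrite -/(hc2 p); nra.
    have -> : \sum_p ((1 - s) * hc2 p + s * h' p) * a I p =
        (1 - s) * (\sum_p hc2 p * a I p) + s * \sum_p h' p * a I p.
      by rewrite !mulr_sumr -big_split; apply: eq_bigr => p _ /=; ring.
    by have := fc I; have := Fh'.2 I; rewrite -/(hc2 _); nra.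
have {}first : \sum_p row_sum g p * (h' p / hc2 p) <= gam + e.
  move: first; under eq_bigr do rewrite mulrBr mulr1.
  by rewrite sumrB; lra.
have h'd : \sum_p h' p * ((row_sum g p + 2 * e) / hc2 p) <= 3 * gam / 2.
  have -> : \sum_p h' p * ((row_sum g p + 2 * e) / hc2 p) =
     \sum_p row_sum g p * (h' p / hc2 p) + 2 * e * \sum_p h' p / hc2 p.
    by rewrite mulr_sumr -big_split; apply: eq_bigr => p _ /=; ring.
  have : \sum_p h' p / hc2 p <= n * M'.
    rewrite /n mulr_natl -sumr_const; apply: ler_sum => p _.
    by case/andP: (rM p).
  by move=> /(ler_wpM2l (ltW e0)); lra.
apply: (@le_trans _ _ (2 * \sum_p h' p * ((row_sum g p + 2 * e) / hc2 p))).
  rewrite mulr_sumr; apply: ler_sum => p _; rewrite mulrA.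
  apply: ler_wpM2r; last by rewrite /h'; lra.
  by rewrite divr_ge0 ?(ltW (hc0 p)) //; have := row_ge p; lra.
lra.
Qed.

End Domination.

(** * Domination by diagonal matrices *)

Section DominatingMixture.
Context {R : realType} {P : finType} {T : Type}.

(* Coordinates on which every [a I] vanishes are unconstrained, so the form
   vanishes on them; giving them weight 1 restores positivity of the
   weights. *)
Lemma dominating_mixture (i0 : T) (a : T -> P -> R) (B : R)
    (G : P -> P -> R[i]) (gam : R) :
    (forall I p, 0 <= a I p <= B) -> (forall p q, G q p = (G p q)^*) ->
    (forall v, 0 <= hermitian_form G v) -> 0 < gam ->
    (forall v, feasible a (fun p => normc (v p) ^+ 2) ->
       hermitian_form G v <= gam) ->
  exists l, [/\ weights_ge0 l, total_weight l = 24 * gam &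
    forall v, hermitian_form G v <= \sum_p mixture a l p * normc (v p) ^+ 2].
Proof.
move=> a_bound G_sym G_ge0 gam0 form_le.
pose live p := `[< exists I, 0 < a I p >].
have dead I p : ~~ live p -> a I p = 0.
  move=> /asboolPn h; have /andP[] := a_bound I p; rewrite le_eqVlt.
  by case: eqP => // _ /= ap; case: h; exists I.
pose a' I p := if live p then a I p else 1.
have a'_bound I p : 0 <= a' I p <= Num.max B 1.
  rewrite /a' !le_max; case: ifP; last by rewrite ler01 lexx orbT.
  by have /andP[-> ->] := a_bound I p.
have a'_pos p : exists I, 0 < a' I p.
  have [lp|/negbTE lp] := boolP (live p); rewrite /a' lp; last by exists i0.
  by have [I aI] := asboolP _ lp; exists I.
have sub_feasible (h : P -> R) : (forall p, 0 <= h p) -> feasible a' h ->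
    feasible a h.
  move=> h0 fh I; apply: le_trans (fh I); apply: ler_sum => p _.
  rewrite ler_wpM2l // /a'; case: ifPn => // /dead ->; exact: ler01.
have [d [d0 dG dh]] := diagonal_domination a' _ G gam a'_bound G_sym G_ge0 gam0
  (fun v fv => form_le v (sub_feasible _ (fun p => sqr_ge0 _) fv)) a'_pos.
have gam30 : 0 < 3 * gam by rewrite mulr_gt0.
have [l [l0 lc ld]] := feasible_dual_mixture a' _ a'_bound i0 d _ gam30 d0 dh.
exists (scale_weights 8 l); split.
- by apply: scale_weights_ge0.
- by rewrite total_scale_weights lc; ring.
move=> v.
pose v1 p := if live p then v p else 0; pose v2 p := if live p then 0 else v p.
have -> : v = (fun p => v1 p + v2 p).
  by apply/funext => p; rewrite /v1 /v2; case: ifP => _; rewrite ?addr0 ?add0r.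
apply: le_trans (hermitian_formD_le _ _ _ G_ge0) _.
have v2le : hermitian_form G v2 <= 0.
  rewrite leNgt; apply/negP => v20.
  (* Every multiple of [v2] is feasible, so if its form were positive it could be rescaled to take
     the value [2 * gam]. *)
  pose k := Num.sqrt (2 * gam / hermitian_form G v2).
  have := form_le (fun p => k%:C * v2 p); rewrite hermitian_formZ sqr_sqrtr.
    rewrite divfK ?gt_eqF // => h; suff : 2 * gam <= gam by lra.
    apply: h => I; rewrite big1 // => p _; rewrite /v2; case: ifPn => [_|/dead ->].
      by rewrite mulr0 normc0 expr0n mul0r.
    by rewrite mulr0.
  by rewrite divr_ge0 ?mulr_ge0 // ltW.
have := dG v1.
suff : \sum_p d p * normc (v1 p) ^+ 2 <=
   4^-1 * \sum_p mixture a (scale_weights 8 l) p * normc (v1 p + v2 p) ^+ 2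
  by lra.
rewrite mulr_sumr; apply: ler_sum => p _; rewrite mixture_scale_weights.
rewrite /v1 /v2; case: ifPn => [lp|_]; last first.
  rewrite normc0 expr0n mulr0 mulr_ge0 // mulr_ge0 ?sqr_ge0 // mulr_ge0 //.
  by have /andP[] := mixture_bound a _ a_bound l p l0.
have -> : mixture a l p = mixture a' l p.
  by apply: eq_bigr => u _; rewrite /a' lp.
rewrite addr0; have := ler_wpM2r (sqr_ge0 (normc (v p))) (ld p); lra.
Qed.

End DominatingMixture.

(** * The Loewner order as an inequality between forms *)

Section LoewnerOrder.
Context {R : realType} {P : finType}.
Implicit Types (G : P -> P -> R[i]) (w : P -> R).

Definition gram_mx G : 'M[R[i]]_#|P| :=
  \matrix_(i, j) G (enum_val i) (enum_val j).

Definition weight_mx w : 'M[R[i]]_#|P| := diag_mx (\row_i (w (enum_val i))%:C).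

Lemma conjcE (z : R[i]) : Num.conj z = z^*.
Proof. by []. Qed.

Lemma Re_sum (I : Type) (r : seq I) (F : I -> R[i]) :
  complex.Re (\sum_(i <- r) F i) = \sum_(i <- r) complex.Re (F i).
Proof. by elim/big_rec2: _ => //= i x y _ <-; case: (F i) y => [u1 u2] [y1 y2]. Qed.

Lemma gram_mx_quadratic G (v : 'rV[R[i]]_#|P|) :
  complex.Re ((v *m gram_mx G *m map_mx Num.conj v^T) 0 0) =
  hermitian_form G (fun p => v 0 (enum_rank p)).
Proof.
rewrite mxE Re_sum.
rewrite (reindex _ (onW_bij _ (@enum_rank_bij P))) /= /hermitian_form.
rewrite exchange_big; apply: eq_bigr => q _.
rewrite mxE mulr_suml Re_sum (reindex _ (onW_bij _ (@enum_rank_bij P))) /=.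
apply: eq_bigr => p _; rewrite !mxE !enum_rankK conjcE; congr complex.Re.
by rewrite mulrAC.
Qed.

Lemma weight_mx_quadratic w (v : 'rV[R[i]]_#|P|) :
  complex.Re ((v *m weight_mx w *m map_mx Num.conj v^T) 0 0) =
  \sum_p w p * normc (v 0 (enum_rank p)) ^+ 2.
Proof.
rewrite mxE Re_sum (reindex _ (onW_bij _ (@enum_rank_bij P))) /=.
apply: eq_bigr => p _; rewrite mul_mx_diag !mxE enum_rankK conjcE normc_sqr.
by case: (v 0 _) => x y /=; ring.
Qed.

Lemma hermsym_sub G w : (forall p q, G q p = (G p q)^*) ->
  weight_mx w - gram_mx G \is hermsymmx.
Proof.
move=> GC; apply/is_hermitianmxP; rewrite expr0 scale1r.
apply/matrixP => i j; rewrite !mxE rmorphB /= rmorphMn /= !conjcE -GC eq_sym.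
by case: eqP => [->|]; rewrite ?mulr0n // conjc_real.
Qed.

Lemma hermsym_quadratic_real n (A : 'M[R[i]]_n) (v : 'rV[R[i]]_n) :
  A \is hermsymmx -> complex.Im ((v *m A *m map_mx Num.conj v^T) 0 0) = 0.
Proof.
move=> /is_hermitianmxP; rewrite expr0 scale1r => AH.
set M := _ *m _; suff : (M 0 0)^* = M 0 0 by case: (M 0 0) => x y [] /=; lra.
have -> : (M 0 0)^* = (map_mx Num.conj M^T) 0 0 by rewrite !mxE.
rewrite /M !trmx_mul !map_mxM mulmxA; congr ((_ *m _ *m _) 0 0).
  by apply/matrixP => i j; rewrite !mxE; exact: conjCK.
exact: esym AH.
Qed.

Lemma loewner_le_weight G w : (forall p q, G q p = (G p q)^*) ->
  loewner_le (gram_mx G) (weight_mx w) <->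
  forall v, hermitian_form G v <= \sum_p w p * normc (v p) ^+ 2.
Proof.
move=> GC.
have hq (v : 'rV[R[i]]_#|P|) : complex.Re ((v *m (weight_mx w - gram_mx G)
      *m map_mx Num.conj v^T) 0 0) =
    \sum_p w p * normc (v 0 (enum_rank p)) ^+ 2
    - hermitian_form G (fun p => v 0 (enum_rank p)).
  rewrite -weight_mx_quadratic -(gram_mx_quadratic G v) mulmxBr mulmxBl.
  move: (_ *m weight_mx w *m _) (_ *m gram_mx G *m _) => X Y.
  by rewrite !mxE; case: (X 0 0) (Y 0 0) => [? ?] [? ?].
split=> [[_ hpsd] v|hle].
  have := hpsd (\row_i v (enum_val i)); rewrite lecE hq => /andP[_].
  have -> : (fun p => (\row_i v (enum_val i)) 0 (enum_rank p)) = v.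
    by apply/funext => p; rewrite mxE enum_rankK.
  under eq_bigr do rewrite mxE enum_rankK.
  by rewrite subr_ge0.
split; first exact: hermsym_sub.
(* Nonnegativity in [R[i]] includes a vanishing imaginary part, supplied by Hermitian symmetry. *)
move=> v; rewrite lecE hq hermsym_quadratic_real; last exact: hermsym_sub.
by rewrite eqxx /= subr_ge0 hle.
Qed.

Lemma sum_weight_mx M (lam : 'I_M -> R) (w : 'I_M -> P -> R) :
  \sum_(m < M) (lam m)%:C *: weight_mx (w m) =
  weight_mx (fun p => \sum_(m < M) lam m * w m p).
Proof.
apply/matrixP => i j; rewrite summxE !mxE rmorph_sum -sumrMnl.
by apply: eq_bigr => m _; rewrite !mxE rmorphM mulrnAr.
Qed.

End LoewnerOrder.

(** * Measurability *)

Section MeasurableComplexFunctions.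
Context {R : realType} {d} {T : measurableType d}.
Implicit Types (f g : T -> R[i]) (u v : T -> R).

Definition cmeasurable f :=
  measurable_fun setT (fun x => complex.Re (f x)) /\
  measurable_fun setT (fun x => complex.Im (f x)).

Lemma cmeasurable_complex u v : measurable_fun setT u -> measurable_fun setT v ->
  cmeasurable (fun x => u x +i* v x).
Proof. by []. Qed.

Lemma cmeasurable_real u : measurable_fun setT u ->
  cmeasurable (fun x => (u x)%:C).
Proof. by move=> mu; split=> //; exact: measurable_cst. Qed.

Lemma cmeasurableD f g : cmeasurable f -> cmeasurable g ->
  cmeasurable (fun x => f x + g x).
Proof.
move=> [f1 f2] [g1 g2]; split.
  apply: eq_measurable_fun (measurable_funD f1 g1) => x _ /=.
  by case: (f x) (g x) => [? ?] [? ?].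
apply: eq_measurable_fun (measurable_funD f2 g2) => x _ /=.
by case: (f x) (g x) => [? ?] [? ?].
Qed.

Lemma cmeasurableM f g : cmeasurable f -> cmeasurable g ->
  cmeasurable (fun x => f x * g x).
Proof.
move=> [f1 f2] [g1 g2]; split.
  apply: (eq_measurable_fun (fun x => complex.Re (f x) * complex.Re (g x)
                                 - complex.Im (f x) * complex.Im (g x))).
    by move=> x _; case: (f x) (g x) => [? ?] [? ?].
  by apply: measurable_funB; exact: measurable_funM.
apply: (eq_measurable_fun (fun x => complex.Re (f x) * complex.Im (g x)
                                 + complex.Im (f x) * complex.Re (g x))).
  by move=> x _; case: (f x) (g x) => [? ?] [? ?].
by apply: measurable_funD; exact: measurable_funM.
Qed.

Lemma cmeasurable_conj f : cmeasurable f -> cmeasurable (fun x => (f x)^*).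
Proof.
move=> [f1 f2]; split.
  by apply: eq_measurable_fun f1 => x _; case: (f x).
by apply: eq_measurable_fun (measurable_funN f2) => x _ /=; case: (f x).
Qed.

Lemma cmeasurableN f : cmeasurable f -> cmeasurable (fun x => - f x).
Proof.
move=> [f1 f2]; split.
  by apply: eq_measurable_fun (measurable_funN f1) => x _ /=; case: (f x).
by apply: eq_measurable_fun (measurable_funN f2) => x _ /=; case: (f x).
Qed.

Lemma measurable_normc_sqr f : cmeasurable f ->
  measurable_fun setT (fun x => normc (f x) ^+ 2).
Proof.
move=> [f1 f2]; apply: (eq_measurable_fun (fun x => complex.Re (f x) ^+ 2
    + complex.Im (f x) ^+ 2)) => [x _|]; first by rewrite normc_sqr.
by apply: measurable_funD; exact: measurable_funX.
Qed.

Lemma measurable_normc f : cmeasurable f ->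
  measurable_fun setT (fun x => normc (f x)).
Proof.
move=> mf; apply: (eq_measurable_fun (fun x => Num.sqrt (normc (f x) ^+ 2))).
  by move=> x _; rewrite sqrtr_sqr ger0_norm //; case: (f x) => *; exact: sqrtr_ge0.
apply: (measurableT_comp _ (measurable_normc_sqr _ mf)).
by apply: continuous_measurable_fun; exact: sqrt_continuous.
Qed.

Lemma measurable_inv_ge0 u : measurable_fun setT u -> (forall x, 0 <= u x) ->
  measurable_fun setT (fun x => (u x)^-1).
Proof.
move=> mu u0; apply: (eq_measurable_fun (fun x => (u x) `^ (-1))).
  by move=> x _; rewrite powR_inv1.
exact: (measurableT_comp (measurable_powR _)).
Qed.

Lemma cmeasurableV f : cmeasurable f -> cmeasurable (fun x => (f x)^-1).
Proof.
move=> mf.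
(* This also holds at zeros of [f], where both sides are 0. *)
have -> : (fun x => (f x)^-1) =
    (fun x => (f x)^* * ((normc (f x) ^+ 2)^-1)%:C).
  apply/funext => x; rewrite normc_sqr; case: (f x) => a b /=.
  apply/eqP; rewrite eq_complex /=; apply/andP; split; apply/eqP; ring.
apply: cmeasurableM; first exact: cmeasurable_conj.
apply: cmeasurable_real; apply: measurable_inv_ge0; last by move=> x; exact: sqr_ge0.
exact: measurable_normc_sqr.
Qed.

(** Precomposed with truncation to [[-1, 1]], [acos] is monotone on the whole line, hence
    measurable. *)
Lemma measurable_acos u : measurable_fun setT u -> (forall x, -1 <= u x <= 1) ->
  measurable_fun setT (fun x => acos (u x)).
Proof.
move=> mu hu; pose clamp (y : R) := Num.max (-1) (Num.min 1 y).
have clampP y : -1 <= clamp y <= 1.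
  by rewrite /clamp le_max lexx /= ge_max ge_min lexx /= andbT; lra.
apply: (eq_measurable_fun (fun x => acos (clamp (u x)))).
  by move=> x _; have /andP[u1 u2] := hu x; rewrite /clamp (min_idPr u2) (max_idPr u1).
apply: (measurableT_comp (f := fun y => acos (clamp y))) => //.
apply: nonincreasing_measurable => // y z yz.
have [hy hz] := (clampP y, clampP z).
rewrite leNgt -ltr_cos ?in_itv /= ?acos_ge0 ?acos_lepi // !acosK ?in_itv //=.
rewrite -leNgt.
by rewrite /clamp; case: (leP 1 y); case: (leP 1 z) => *;
  rewrite !(maxElt, minElt); do ! case: ifP; lra.
Qed.

Lemma normc_ge0 (z : R[i]) : 0 <= normc z.
Proof. by case: z => x y; exact: sqrtr_ge0. Qed.

Lemma normr_Re_le (z : R[i]) : `|complex.Re z| <= normc z.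
Proof.
rewrite -(@ler_pXn2r _ 2) ?nnegrE ?normr_ge0 ?normc_ge0 // normc_sqr.
by rewrite real_normK ?num_real // lerDl sqr_ge0.
Qed.

Lemma normr_Im_le (z : R[i]) : `|complex.Im z| <= normc z.
Proof.
rewrite -(@ler_pXn2r _ 2) ?nnegrE ?normr_ge0 ?normc_ge0 // normc_sqr.
by rewrite real_normK ?num_real // lerDr sqr_ge0.
Qed.

Lemma Re_div_normc_itv (z : R[i]) : -1 <= complex.Re z / normc z <= 1.
Proof.
rewrite -ler_norml normrM normfV (ger0_norm (normc_ge0 z)).
have [->|z0] := eqVneq (normc z) 0; first by rewrite invr0 mulr0.
by rewrite ler_pdivrMr ?mul1r ?normr_Re_le // lt0r z0 normc_ge0.
Qed.

Lemma measurable_cos_angle f : cmeasurable f ->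
  measurable_fun setT (fun x => acos (complex.Re (f x) / normc (f x))).
Proof.
move=> mf; apply: measurable_acos => [|x]; last exact: Re_div_normc_itv.
apply: measurable_funM; first by case: mf.
by apply: measurable_inv_ge0; [exact: measurable_normc | move=> x; exact: normc_ge0].
Qed.

Lemma measurable_carg f : cmeasurable f ->
  measurable_fun setT (fun x => carg (f x)).
Proof.
move=> mf; apply: measurable_fun_ifT.
- by apply: measurable_fun_ler; [exact: measurable_cst | case: mf].
- exact: measurable_cos_angle.
- by apply: measurable_funN; exact: measurable_cos_angle.
Qed.

Lemma cmeasurable_cpow f (s : R) : cmeasurable f ->
  cmeasurable (fun x => cpow (f x) s).
Proof.
move=> mf; apply: cmeasurableM.
  apply: cmeasurable_real.
  exact: (measurableT_comp (measurable_powR _) (measurable_normc _ mf)).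
have ms : measurable_fun setT (fun x => s * carg (f x)).
  by apply: measurable_funM; [exact: measurable_cst | exact: measurable_carg].
apply: cmeasurable_complex; apply: (measurableT_comp _ ms).
  by apply: continuous_measurable_fun; exact: continuous_cos.
by apply: continuous_measurable_fun; exact: continuous_sin.
Qed.

End MeasurableComplexFunctions.

(** * Polar coordinates and the dyadic cells *)

Section Cells.
Context {R : realType}.
Implicit Types x : plane R.

Lemma cmeasurable_toC : cmeasurable (@toC R).
Proof. by split; [exact: measurable_fst | exact: measurable_snd]. Qed.

Lemma measurable_sublevel d (T : measurableType d) (u v : T -> R) :
  measurable_fun setT u -> measurable_fun setT v ->
  measurable [set x | u x < v x].
Proof.
move=> mu mv; rewrite -[X in measurable X]setTI.
exact: (measurable_fun_ltr mu mv measurableT (Y := [set true])).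
Qed.

Lemma measurable_sublevel_le d (T : measurableType d) (u v : T -> R) :
  measurable_fun setT u -> measurable_fun setT v ->
  measurable [set x | u x <= v x].
Proof.
move=> mu mv; rewrite -[X in measurable X]setTI.
exact: (measurable_fun_ler mu mv measurableT (Y := [set true])).
Qed.

Lemma measurable_disc : measurable (@disc R).
Proof.
apply: measurable_sublevel; last exact: measurable_cst.
exact/measurable_normc/cmeasurable_toC.
Qed.

(** The argument in [[0, 2 * pi[] rather than the principal one, so that no cell wraps around the
    cut. *)
Definition angle x : R :=
  let a := acos (complex.Re (toC x) / normc (toC x)) in
  if 0 <= x.2 then a else 2 * pi - a.

Lemma measurable_angle : measurable_fun setT angle.
Proof.
apply: measurable_fun_ifT.
- by apply: measurable_fun_ler; [exact: measurable_cst | exact: measurable_snd].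
- exact/measurable_cos_angle/cmeasurable_toC.
- apply: measurable_funB; first exact: measurable_cst.
  exact/measurable_cos_angle/cmeasurable_toC.
Qed.

Lemma normc_polar (r t : R) : 0 <= r -> normc (toC (polar r t)) = r.
Proof.
move=> r0; rewrite /= !exprMn -mulrDr cos2Dsin2 mulr1 sqrtr_sqr ger0_norm //.
Qed.

Lemma angle_polar (r t : R) : 0 < r -> 0 <= t < 2 * pi -> angle (polar r t) = t.
Proof.
move=> r0 /andP[t0 t2]; rewrite /angle normc_polar /=; last exact: ltW.
rewrite mulrAC mulfV ?gt_eqF // mul1r pmulr_rge0 //.
have [tpi|pit] := leP t pi.
  by rewrite sin_ge0_pi ?t0 // cosK // in_itv /= t0.
have ct : cos t = cos (2 * pi - t).
  have -> : 2 * pi - t = - t + pi + pi by ring.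
  by rewrite !cosDpi opprK cosN.
have st : sin t = - sin (t - pi) by rewrite -sinDpi subrK.
have -> : (0 <= sin t) = false.
  apply/negbTE; rewrite -ltNge st oppr_lt0 sin_gt0_pi //.
  by apply/andP; split; lra.
rewrite ct cosK ?in_itv /=; last by apply/andP; split; lra.
ring.
Qed.

Lemma polar_angle x : polar (normc (toC x)) (angle x) = x.
Proof.
have [r0|r0] := eqVneq (normc (toC x)) 0.
  have := normr_Re_le (toC x); have := normr_Im_le (toC x).
  rewrite r0 !normr_le0 /polar !mul0r; case: x r0 => x1 x2 /= _.
  by move=> /eqP-> /eqP->.
have rp : 0 < normc (toC x) by rewrite lt0r r0 normc_ge0.
have hc := Re_div_normc_itv (toC x).
rewrite /polar /angle; set u := complex.Re (toC x) / _ in hc *.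
have hu : normc (toC x) * u = x.1 by rewrite mulrC divfK.
have hs : normc (toC x) * sin (acos u) = `|x.2|.
  apply/eqP; rewrite -(@eqrXn2 _ 2) ?normr_ge0 ?mulr_ge0 ?normc_ge0 //.
    rewrite real_normK ?num_real // exprMn sin_acos // [X in _ * X]sqr_sqrtr; last by nra.
    by rewrite mulrBr mulr1 -exprMn hu normc_sqr /= addrC addKr.
  by rewrite sin_acos // sqrtr_ge0.
have cu : cos (acos u) = u by rewrite acosK // in_itv.
rewrite [RHS]surjective_pairing; case: ifPn => [x0|].
  by rewrite cu hu hs ger0_norm.
rewrite -ltNge => x0.
have -> : 2 * pi - acos u = - acos u + pi + pi by ring.
by rewrite cosDpi cosDpi sinDpi sinDpi !opprK cosN sinN mulrN cu hu hs ltr0_norm // opprK.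
Qed.

(** The disjunct [normc (toC x) = 0] is there because [polar 0 t] is the origin for every [t]: the
    origin belongs to all cells with radial index 0. *)
Lemma cellE N (p : cell_index N) : cell p =
  [set x | p.1%:R / 2 ^+ N <= normc (toC x) ^+ 2 < p.1.+1%:R / 2 ^+ N /\
    (normc (toC x) = 0 \/
     2 * pi * p.2%:R / 2 ^+ N <= angle x < 2 * pi * p.2.+1%:R / 2 ^+ N)].
Proof.
have pi0 := @pi_gt0 R; have N0 : 0 < 2 ^+ N :> R by rewrite exprn_gt0.
apply/seteqP; split=> [x [r [t [r0 hr ht ->]]]|x [hr ht]].
  split; rewrite normc_polar //.
  move: r0; rewrite le_eqVlt => /predU1P[<-|r0]; [by left | right].
  rewrite angle_polar //; case/andP: ht => t1 t2; apply/andP; split.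
    by apply: le_trans t1; rewrite !mulr_ge0 // ?invr_ge0 ltW.
  apply: lt_le_trans t2 _; rewrite ler_pdivrMr // ler_pM2l ?mulr_gt0 //.
  by rewrite -natrX ler_nat ltn_ord.
have [r0|r0] := eqVneq (normc (toC x)) 0.
  exists 0, (2 * pi * p.2%:R / 2 ^+ N); split => //.
  - by rewrite r0 in hr.
  - rewrite lexx /= ltr_pM2r ?invr_gt0 // ltr_pM2l ?mulr_gt0 //.
    by rewrite ltr_nat.
  - by rewrite -{1}(polar_angle x) r0 /polar !mul0r.
exists (normc (toC x)), (angle x); split => //; first exact: normc_ge0.
  by case: ht => // /eqP; rewrite (negbTE r0).
by rewrite polar_angle.
Qed.

Lemma measurable_cell N (p : cell_index N) : measurable (@cell R N p).
Proof.
have mr := measurable_normc _ cmeasurable_toC.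
have mr2 := measurable_normc_sqr _ cmeasurable_toC.
have ma := measurable_angle.
have itvE (u : plane R -> R) (a b : R) : measurable_fun setT u ->
    measurable [set x | a <= u x < b].
  move=> mu; have -> : [set x | a <= u x < b] =
      [set x | a <= u x] `&` [set x | u x < b].
    by apply/seteqP; split => x /= => [/andP[]|[-> ->]].
  apply: measurableI.
    by apply: measurable_sublevel_le => //; exact: measurable_cst.
  by apply: measurable_sublevel => //; exact: measurable_cst.
rewrite cellE; apply: measurableI; first exact: itvE.
apply: measurableU; last exact: itvE.
by have := mr measurableT [set 0] (measurable_set1 _); rewrite setTI.
Qed.

Lemma cell_sub_disc N (p : cell_index N) : cell p `<=` @disc R.
Proof.
rewrite cellE => x [/andP[_ hr] _]; rewrite /disc /=.
rewrite -(@ltr_pXn2r _ 2) ?nnegrE ?normc_ge0 // expr1n.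
apply: lt_le_trans hr _; rewrite ler_pdivrMr ?exprn_gt0 // mul1r.
by rewrite -natrX ler_nat ltn_ord.
Qed.

End Cells.

(** * Measurability of integrals depending on a parameter *)

Section ParametricIntegrals.
Context {R : realType} {d1 d2} {T1 : measurableType d1} {T2 : measurableType d2}.
Variable nu : {measure set T2 -> \bar R}.
Hypothesis nu_sfinite : sigma_finite setT nu.

Let ge0_measurable_integral (f : T1 * T2 -> \bar R) :
  measurable_fun setT f -> (forall x, 0 <= f x)%E ->
  measurable_fun setT (fun x => \int[nu]_y f (x, y))%E.
Proof.
move=> mf f0.
(* Tonelli's theorem takes a bundled sigma-finite measure, whereas [nu] comes with a mere proof; the
   bundle is built here. *)
pose H1 := isSFinite.Build _ _ _ _ (sfinite_measure_sigma_finite nu_sfinite).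
pose H2 := isSigmaFinite.Build _ _ _ _ nu_sfinite.
pose nu' : {sigma_finite_measure set T2 -> \bar R} :=
  HB.pack_for (SigmaFiniteMeasure.type T2 R) (Measure.sort nu) H1 H2.
have -> : nu = nu' by exact: eq_measure.
exact: (@measurable_fun_fubini_tonelli_F _ _ _ _ _ nu' f mf f0).
Qed.

Lemma measurable_Rintegral (D : set T2) (f : T1 * T2 -> R) : measurable D ->
  measurable_fun setT f -> measurable_fun setT (fun x => Rintegral nu D (fun y => f (x, y))).
Proof.
move=> mD mf; apply: (measurableT_comp (fine_measurable _)) => //.
pose g z : \bar R := ((f \_ (setT `*` D)) z)%:E.
have mg : measurable_fun setT g.
  apply/measurable_EFinP; have mSD : measurable (setT `*` D : set (T1 * T2)).
    exact: measurableX.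
  by apply/(measurable_restrictT _ mSD); exact: measurable_funTS.
apply: (eq_measurable_fun (fun x =>
    (\int[nu]_y (g^\+ (x, y))) - \int[nu]_y (g^\- (x, y))))%E.
  move=> x _; rewrite [in RHS]integral_mkcond.
  have -> : (EFin \o (fun y => f (x, y))) \_ D = (fun y => g (x, y)).
    by apply/funext => y; rewrite /g !patchE in_setX in_setT /=; case: ifP.
  rewrite [RHS]integralE; congr (_ - _)%E; apply: eq_integral => y _.
    by rewrite !funeposE.
  by rewrite !funenegE.
apply: emeasurable_funB; apply: ge0_measurable_integral => //.
- exact: measurable_funepos.
- exact: measurable_funeneg.
Qed.

Lemma cmeasurable_cintegral (D : set T2) (f : T1 * T2 -> R[i]) : measurable D ->
  cmeasurable f -> cmeasurable (fun x => cintegral nu D (fun y => f (x, y))).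
Proof.
by move=> mD [mRe mIm]; split; [exact: (measurable_Rintegral _ _ mD mRe)
                               |exact: (measurable_Rintegral _ _ mD mIm)].
Qed.

End ParametricIntegrals.

Section PacketMeasurability.
Context {R : realType}.

Lemma area_sigma_finite : sigma_finite setT (@area R).
Proof.
have /sigma_finiteP[F [TF ndF Foo]] := sigma_finiteT (@lebesgue_measure R).
exists (fun n => F n `*` F n).
  apply/seteqP; split => // -[x y] _; have : [set: R] x by []; have : [set: R] y by [].
  rewrite TF => -[k _ Fky] [n _ Fnx]; exists (maxn n k) => //; split.
    by move: x Fnx; exact/subsetPset/ndF/leq_maxl.
  by move: y Fky; exact/subsetPset/ndF/leq_maxr.
move=> k; have [mF Fk] := Foo k; split; first exact: measurableX.
rewrite /area /= /mscale /= product_measure1E //.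
apply: lte_mul_pinfty => //; first by rewrite lee_fin divr_ge0 ?pi_ge0.
by apply: lte_mul_pinfty => //; rewrite ge0_fin_numE.
Qed.

(** Uncurried as [((z, w), t)], so that measurability in [z] follows by integrating out [t] and then
    [w]. *)
Definition kernel_integrand (b : R) (u : (plane R * plane R) * measurableTypeR R) : R[i] :=
  toC u.1.1 / cpow (1 - u.2%:C * toC u.1.1 * (toC u.1.2)^*) (b + 2).

Lemma cmeasurable_kernel_integrand b : cmeasurable (kernel_integrand b).
Proof.
have m1 : cmeasurable (fun u : (plane R * plane R) * measurableTypeR R => toC u.1.1).
  split; first by do ! apply: (measurableT_comp measurable_fst).
  apply: (measurableT_comp measurable_snd); exact: (measurableT_comp measurable_fst).
have m2 : cmeasurable (fun u : (plane R * plane R) * measurableTypeR R => toC u.1.2).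
  split.
    apply: (measurableT_comp measurable_fst).
    exact: (measurableT_comp measurable_snd measurable_fst).
  apply: (measurableT_comp measurable_snd).
  exact: (measurableT_comp measurable_snd measurable_fst).
have m3 : cmeasurable (fun u : (plane R * plane R) * measurableTypeR R => u.2%:C).
  by apply: cmeasurable_real; exact: measurable_snd.
apply: cmeasurableM => //; apply: cmeasurableV; apply: cmeasurable_cpow.
apply: cmeasurableD; first by split; exact: measurable_cst.
apply: cmeasurableN; apply: cmeasurableM; last exact: cmeasurable_conj.
exact: cmeasurableM.
Qed.

Lemma cmeasurable_kernel_primitive b : cmeasurable
  (fun u : plane R * plane R => kernel_primitive b (toC u.1) (toC u.2)).
Proof.
have sf : sigma_finite setT (@lebesgue_measure R) by exact: sigma_finiteT.
apply: (cmeasurable_cintegral lebesgue_measure sf `[0, 1]%classic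
  (kernel_integrand b)) => //.
exact: cmeasurable_kernel_integrand.
Qed.

Definition packet_integrand (b : R) (u : plane R * plane R) : R[i] :=
  kernel_primitive b (toC u.1) (toC u.2) *
  ((b + 1) * (1 - (normc (toC u.2)) ^+ 2) `^ b)%:C.

Lemma cmeasurable_packet_integrand b : cmeasurable (packet_integrand b).
Proof.
apply: cmeasurableM; first exact: cmeasurable_kernel_primitive.
apply: cmeasurable_real; apply: measurable_funM; first exact: measurable_cst.
apply: (measurableT_comp (measurable_powR _)).
apply: measurable_funB; first exact: measurable_cst.
apply: measurable_normc_sqr; split.
  exact: (measurableT_comp measurable_fst measurable_snd).
exact: (measurableT_comp measurable_snd measurable_snd).
Qed.

Lemma cmeasurable_packet b N (p : cell_index N) :
  cmeasurable (fun x : plane R => packet b p (toC x)).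
Proof.
apply: (cmeasurable_cintegral _ area_sigma_finite _ (packet_integrand b)).
  exact: measurable_cell.
exact: cmeasurable_packet_integrand.
Qed.

End PacketMeasurability.

(** * Bounds on the packets *)

Section SingularWeight.
Context {R : realType}.
Implicit Types e u x y : R.

(** Regularization of [|y|^(-2/3)] at scale [e]; the product of three such factors controls an
    inverse square. *)
Definition rho e y : R := (y ^+ 2 + e ^+ 2) `^ (- 3^-1).

Lemma rho_ge0 e y : 0 <= rho e y.
Proof. exact: powR_ge0. Qed.

Lemma rho_cube e y : rho e y ^+ 3 = (y ^+ 2 + e ^+ 2)^-1.
Proof.
have q0 : 0 <= y ^+ 2 + e ^+ 2 by rewrite addr_ge0 ?sqr_ge0.
rewrite -powR_mulrn ?rho_ge0 // -powRrM mulNr mulVf // powR_inv1 //.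
Qed.

Let prim e u x := (x - u) * rho e (x - u).

Let prim' e u x := rho e (x - u) +
  (x - u) * ((- 3^-1) * ((x - u) ^+ 2 + e ^+ 2) `^ (- 3^-1 - 1) * (2 * (x - u))).

Let is_derive_powq e u a x : 0 < e ->
  is_derive x 1 (fun t => ((t - u) ^+ 2 + e ^+ 2) `^ a)
    (a * ((x - u) ^+ 2 + e ^+ 2) `^ (a - 1) * (2 * (x - u))).
Proof.
move=> e0; have q0 : 0 < (x - u) ^+ 2 + e ^+ 2.
  by rewrite ltr_wpDl ?sqr_ge0 ?exprn_gt0.
have d1 : is_derive x 1 (fun t : R => t - u) 1.
  apply: (is_derive_eq (is_deriveB (is_derive_id x 1) (is_derive_cst u x 1))).
  by rewrite subr0.
have d2 : is_derive x 1 (fun t : R => (t - u) ^+ 2 + e ^+ 2) (2 * (x - u)).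
  apply: (is_derive_eq (is_deriveD (is_deriveX 2 d1) (is_derive_cst (e ^+ 2) x 1))).
  by rewrite addr0 expr1 /GRing.scale /= mulr1.
exact: (@is_derive1_comp _ (fun y => y `^ a) (fun t => (t - u) ^+ 2 + e ^+ 2)
  _ _ _ (is_derive1_powR a q0) d2).
Qed.

Let is_derive_prim e u x : 0 < e -> is_derive x 1 (prim e u) (prim' e u x).
Proof.
move=> e0; have d1 : is_derive x 1 (fun t : R => t - u) 1.
  apply: (is_derive_eq (is_deriveB (is_derive_id x 1) (is_derive_cst u x 1))).
  by rewrite subr0.
apply: (is_derive_eq (is_deriveM d1 (is_derive_powq e u (- 3^-1) x e0))).
rewrite /prim' /rho /GRing.scale /=; ring.
Qed.

Let continuous_powq e u a : 0 < e ->
  continuous (fun t => ((t - u) ^+ 2 + e ^+ 2) `^ a).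
Proof.
move=> e0 x; apply: differentiable_continuous; apply/derivable1_diffP.
by have [] := is_derive_powq e u a x e0.
Qed.

Let continuous_prim' e u : 0 < e -> continuous (prim' e u).
Proof.
move=> e0 x.
have cs : (fun t : R => t - u) t @[t --> x] --> x - u.
  by apply: cvgB; [exact: cvg_id | exact: cvg_cst].
apply: cvgD; first exact: continuous_powq.
apply: cvgM => //; apply: cvgM; last by apply: cvgM => //; exact: cvg_cst.
by apply: cvgM; [exact: cvg_cst | exact: continuous_powq].
Qed.

Lemma measurable_rho e u : 0 < e ->
  measurable_fun setT (fun x : R => rho e (x - u)).
Proof. by move=> e0; apply: continuous_measurable_fun; exact: continuous_powq. Qed.

(** With [q = (x - u)^2 + e^2], the derivative of the primitive is
    [rho * (1 - 2 (x - u)^2 / (3 q))], and [(x - u)^2 <= q] leaves at least a third of [rho]. *)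
Let rho_le_prim' e u x : 0 < e -> rho e (x - u) <= 3 * prim' e u x.
Proof.
move=> e0; rewrite /prim' /rho; set q := _ ^+ 2 + _.
have q0 : 0 < q by rewrite ltr_wpDl ?sqr_ge0 ?exprn_gt0.
have -> : q `^ (- 3^-1 - 1) = q `^ (- 3^-1) * q^-1.
  by rewrite powRD ?powR_inv1 ?(ltW q0) // (gt_eqF q0) implybT.
have p0 := powR_ge0 q (- 3^-1); move: (q `^ _) p0 => p p0.
suff h : (x - u) ^+ 2 * q^-1 <= 1.
  by have := ler_wpM2l p0 h; move: (q^-1) h => k h; nra.
by rewrite ler_pdivrMr // mul1r /q lerDl sqr_ge0.
Qed.

(** The cube of the left side is [|y|^3 / (y^2 + e^2) <= |y|]. *)
Let prim_bound e y : 0 < e -> `|y| <= 3 -> `|y * rho e y| <= 3.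
Proof.
move=> e0 y3; rewrite normrM (ger0_norm (rho_ge0 _ _)).
rewrite -(@ler_pXn2r _ 3) ?nnegrE ?mulr_ge0 ?rho_ge0 // exprMn rho_cube.
have q0 : 0 < y ^+ 2 + e ^+ 2 by rewrite ltr_wpDl ?sqr_ge0 ?exprn_gt0.
rewrite ler_pdivrMr // exprS -normrX (ger0_norm (sqr_ge0 y)).
have := sqr_ge0 y; have := sqr_ge0 e; have := normr_ge0 y; nra.
Qed.

(* The bound is uniform in [e]: the primitive [y * rho e y] stays bounded as the
   weight degenerates to [|y| `^ (- 2 / 3)]. *)
Lemma integral_rho_le e u : 0 < e -> `|u| <= 2 ->
  (\int[lebesgue_measure]_(x in `[(-1)%R, 1%R]) (rho e (x - u))%:E <= 18%:E)%E.
Proof.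
move=> e0 u2.
apply: (@le_trans _ _ (\int[lebesgue_measure]_(x in `[(-1)%R, 1%R])
    (3 * prim' e u x)%:E)%E).
  apply: ge0_le_integral => //.
  - by move=> x _; rewrite lee_fin rho_ge0.
  - by apply/measurable_EFinP; apply: measurable_funTS; exact: measurable_rho.
  - apply/measurable_EFinP; apply: measurable_funM; first exact: measurable_cst.
    apply: measurable_funTS; apply: continuous_measurable_fun.
    exact: continuous_prim'.
  - by move=> x _; rewrite lee_fin rho_le_prim'.
have dp x : is_derive x 1 (fun t => 3 * prim e u t) (3 * prim' e u x).
  exact: (is_deriveZ 3 (is_derive_prim e u x e0)).
have cp : continuous (fun t => 3 * prim e u t).
  move=> x; apply: differentiable_continuous; apply/derivable1_diffP.
  by have [] := dp x.
(* The constant is 18 = 3 * (3 + 3): both endpoints lie within 3 of [u]. *)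
rewrite (@continuous_FTC2 _ _ (fun t => 3 * prim e u t)) //.
- rewrite -EFinB lee_fin.
  have hb y : `|y| <= 1 -> `|prim e u y| <= 3.
    move=> y1; apply: prim_bound => //.
    by move: y1 u2; rewrite !ler_norml => /andP[? ?] /andP[? ?]; apply/andP; split; lra.
  have := hb 1; have := hb (-1); rewrite normrN normr1 lexx !ler_norml.
  move=> /(_ isT)/andP[h1 h2] /(_ isT)/andP[h3 h4] /=; lra.
- apply: continuous_subspaceT => x; apply: cvgM; first exact: cvg_cst.
  exact: continuous_prim'.
- split=> [x _||]; first by have [] := dp x.
  + exact: cvg_at_right_filter (cp _).
  + exact: cvg_at_left_filter (cp _).
- by move=> x _; rewrite derive1E; have [_] := dp x.
Qed.

End SingularWeight.

(** * Pointwise bounds on the kernel *)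

Section KernelBounds.
Context {R : realType}.
Implicit Types (z w : R[i]) (t b : R).

Lemma normc_real (k : R) : normc k%:C = `|k|.
Proof. by rewrite /normc /= expr0n addr0 sqrtr_sqr. Qed.

Lemma normc_conj z : normc z^* = normc z.
Proof. by case: z => x y /=; rewrite sqrrN. Qed.

Lemma normcD_le z w : normc (z + w) <= normc z + normc w.
Proof. exact: le_normcD. Qed.

Definition denom t z w : R[i] := 1 - t%:C * z * w^*.

(** The first three bounds follow from [|denom| >= 1 - t |z| |w|]. For the last, [1 - z w^*] differs
    from the denominator by [(1 - t) z w^*], of modulus at most [1 - t]. *)
Lemma normc_denom_ge t z w : 0 <= t <= 1 -> normc z < 1 -> normc w < 1 ->
  [/\ 1 - t <= normc (denom t z w), 1 - normc z <= normc (denom t z w),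
      1 - normc w <= normc (denom t z w) &
      normc (1 - z * w^*) <= 2 * normc (denom t z w)].
Proof.
move=> /andP[t0 t1] z1 w1.
have [z0 w0] := (normc_ge0 z, normc_ge0 w).
have h : 1 <= normc (denom t z w) + t * (normc z * normc w).
  have := normcD_le (denom t z w) (t%:C * z * w^*).
  by rewrite subrK normc1 !normcM normc_conj normc_real ger0_norm // mulrA.
have h2 : normc (1 - z * w^*) <=
    normc (denom t z w) + (1 - t) * (normc z * normc w).
  have -> : 1 - z * w^* = denom t z w + - ((1 - t)%:C * (z * w^*)).
    by rewrite /denom rmorphB /=; ring.
  apply: le_trans (normcD_le _ _) _; rewrite normcN !normcM normc_conj normc_real.
  by rewrite ger0_norm ?subr_ge0.
have zw : 0 <= normc z * normc w by exact: mulr_ge0.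
have zw1 : normc z * normc w <= normc z by rewrite ler_piMr // ltW.
have zw2 : normc z * normc w <= normc w by rewrite ler_piMl // ltW.
split; nra.
Qed.

(* The reflection of z in the unit circle, which is where the singularity of
   [1 - z * w^*] lies; it is replaced by 0 when it is far from the disc. *)
Definition center z : R[i] :=
  if 2^-1 <= normc z then z * ((normc z ^+ 2)^-1)%:C else 0.

Lemma normc_center z : normc (center z) <= 2.
Proof.
rewrite /center; case: ifP => [hz|_]; last by rewrite normc0.
have z0 : 0 < normc z by apply: lt_le_trans hz; rewrite invr_gt0.
rewrite normcM normc_real normfV ger0_norm ?sqr_ge0 // expr2 invfM mulrA.
by rewrite mulfV ?gt_eqF // mul1r invf_ple ?posrE.
Qed.

(** For [|z| >= 1/2] the center is [1 / z^*] and [|z| |w - 1 / z^*| = |1 - z w^*| <= 2 |denom|].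
    Otherwise [|denom| >= 1 - |z| > 1/2] while [|w| < 1]. *)
Lemma normc_center_sub t z w : 0 <= t <= 1 -> normc z < 1 -> normc w < 1 ->
  normc (w - center z) <= 4 * normc (denom t z w).
Proof.
move=> t01 z1 w1; have [_ h1 _ h2] := normc_denom_ge t z w t01 z1 w1.
rewrite /center; case: ifPn => [hz|]; last first.
  by rewrite -ltNge subr0 => hz; lra.
have z0 : 0 < normc z by apply: lt_le_trans hz; rewrite invr_gt0.
suff : normc (w - z * ((normc z ^+ 2)^-1)%:C) * normc z = normc (1 - z * w^*).
  have := normc_ge0 (w - z * ((normc z ^+ 2)^-1)%:C); nra.
rewrite -[X in _ * X](normc_conj z) -normcM -[RHS]normcN -[RHS]normc_conj.
congr normc; rewrite mulrBl mulrAC.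
have -> : z * z^* = (normc z ^+ 2)%:C.
  by rewrite normc_sqr; case: z {h1 h2 hz z0 z1} => x y; apply/eqP;
    rewrite eq_complex /=; apply/andP; split; apply/eqP; ring.
have -> : (normc z ^+ 2)%:C * ((normc z ^+ 2)^-1)%:C = 1 :> R[i].
  by apply/eqP; rewrite eq_complex; apply/andP; split; apply/eqP => /=;
    field; rewrite gt_eqF.
case: z w {z1 w1 h1 h2 hz z0} => [z1 z2] [w1 w2].
by apply/eqP; rewrite eq_complex /=; apply/andP; split; apply/eqP; ring.
Qed.

Definition rho_at z w : R :=
  rho (1 - normc z) (complex.Re w - complex.Re (center z)) *
  rho (1 - normc z) (complex.Im w - complex.Im (center z)).

(** Each of [1 - t] and the two coordinates of [w - center z] is at most [4 |denom|] in modulus, and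
    [1 - |z| <= |denom|]; hence 17 = 4^2 + 1. The product of the three resulting cube-root bounds is
    the inverse square. *)
Lemma denom_sqr_inv_le t z w : 0 <= t <= 1 -> normc z < 1 -> normc w < 1 ->
  (normc (denom t z w) ^+ 2)^-1 <=
  17 * (rho (1 - normc z) (t - 1) * rho_at z w).
Proof.
move=> t01 z1 w1; have [h0 h1 h2 _] := normc_denom_ge t z w t01 z1 w1.
have h3 := normc_center_sub t z w t01 z1 w1.
have [t0 t1] := andP t01.
set e := 1 - normc z in h1 *; have e0 : 0 < e by rewrite subr_gt0.
set n := normc (denom t z w) in h0 h1 h2 h3 *.
have n0 : 0 < n by exact: lt_le_trans h1.
have sqr_le x : `|x| <= 4 * n -> x ^+ 2 + e ^+ 2 <= 17 * n ^+ 2.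
  move=> xn; have : `|x| ^+ 2 <= (4 * n) ^+ 2.
    by rewrite ler_pXn2r ?nnegrE // mulr_ge0 // ltW.
  have : e ^+ 2 <= n ^+ 2 by rewrite ler_pXn2r ?nnegrE // ltW.
  by rewrite real_normK ?num_real //; nra.
have rho_ge x : `|x| <= 4 * n -> (17 * n ^+ 2)^-1 <= rho e x ^+ 3.
  move=> /sqr_le h; rewrite rho_cube lef_pV2 ?posrE ?mulr_gt0 ?exprn_gt0 //.
  by rewrite ltr_wpDl ?sqr_ge0 ?exprn_gt0.
have N0 : 0 < 17 * n ^+ 2 by rewrite mulr_gt0 ?exprn_gt0.
have r1 : (17 * n ^+ 2)^-1 <= rho e (t - 1) ^+ 3.
  by apply: rho_ge; rewrite distrC ger0_norm ?subr_ge0 //; lra.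
have ReB : complex.Re (w - center z) = complex.Re w - complex.Re (center z).
  by case: (w) (center z) => [? ?] [? ?].
have ImB : complex.Im (w - center z) = complex.Im w - complex.Im (center z).
  by case: (w) (center z) => [? ?] [? ?].
have r2 := rho_ge _ (le_trans (normr_Re_le _) h3).
have r3 := rho_ge _ (le_trans (normr_Im_le _) h3).
rewrite ReB in r2; rewrite ImB in r3.
have -> : (n ^+ 2)^-1 = 17 * (17 * n ^+ 2)^-1 by field; rewrite gt_eqF.
apply: ler_wpM2l => //.
rewrite -(@ler_pXn2r _ 3) ?nnegrE ?mulr_ge0 ?rho_ge0 ?invr_ge0 ?(ltW N0) //.
have N'0 : 0 <= (17 * n ^+ 2)^-1 by rewrite invr_ge0 ltW.
rewrite /rho_at !exprMn exprS expr2; apply: ler_pM => //; first exact: mulr_ge0.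
exact: ler_pM.
Qed.

Lemma normc_cpow z s : normc (cpow z s) = normc z `^ s.
Proof.
rewrite normcM normc_real ger0_norm ?powR_ge0 // [X in _ * X]/= cos2Dsin2 sqrtr1.
by rewrite mulr1.
Qed.

(** [1 - |w|^2 <= 2 (1 - |w|) <= 2 |denom|], raised to the power [b >= 0], cancels all but an
    inverse square of the kernel. *)
Lemma weighted_integrand_le b t z w : 0 <= b -> 0 <= t <= 1 ->
    normc z < 1 -> normc w < 1 ->
  (1 - normc w ^+ 2) `^ b * normc (z / cpow (denom t z w) (b + 2)) <=
  2 `^ b * 17 * (rho (1 - normc z) (t - 1) * rho_at z w).
Proof.
move=> b0 t01 z1 w1; have [_ h1 h2 _] := normc_denom_ge t z w t01 z1 w1.
have hd := denom_sqr_inv_le t z w t01 z1 w1.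
set n := normc (denom t z w) in h1 h2 hd *.
have n0 : 0 < n by apply: lt_le_trans h1; rewrite subr_gt0.
have w0 := normc_ge0 w.
rewrite -mulrA; apply: le_trans (ler_wpM2l (powR_ge0 _ _) hd).
rewrite normcM normcV normc_cpow -/n powRD; last by rewrite (gt_eqF n0) implybT.
rewrite powR_mulrn ?(ltW n0) // invfM.
have hw : (1 - normc w ^+ 2) `^ b <= 2 `^ b * n `^ b.
  rewrite -powRM ?(ltW n0) //; apply: ge0_ler_powR => //; rewrite ?nnegrE; nra.
have nb : 0 < n `^ b by exact: powR_gt0.
have n2 : 0 <= (n ^+ 2)^-1 by rewrite invr_ge0 sqr_ge0.
rewrite !mulrA; apply: ler_wpM2r => //.
rewrite ler_pdivrMr // mulrC; apply: le_trans hw.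
by rewrite ler_piMl ?powR_ge0 // ltW.
Qed.

End KernelBounds.

(** * Integration of the kernel bound *)

Section PacketBound.
Context {R : realType}.

Lemma normr_Rintegral_le {d} {T : measurableType d} (mu : {measure set T -> \bar R})
    (D : set T) (f g : T -> R) (C : R) : measurable D -> measurable_fun setT f ->
    measurable_fun setT g -> (forall x, D x -> `|f x| <= g x) ->
    (\int[mu]_(x in D) (g x)%:E <= C%:E)%E ->
  `|Rintegral mu D f| <= C.
Proof.
move=> mD mf mg fg gC.
have mfD : measurable_fun D (EFin \o f).
  by apply/measurable_EFinP; exact: measurable_funTS.
have h : (`|\int[mu]_(x in D) (f x)%:E| <= C%:E)%E.
  apply: le_trans (le_abse_integral _ mD mfD) (le_trans _ gC).
  apply: ge0_le_integral => //.
  - exact: measurableT_comp.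
  - by apply/measurable_EFinP; exact: measurable_funTS.
rewrite -[Rintegral mu D f]/(fine (\int[mu]_(x in D) (f x)%:E)%E).
by case: (\int[mu]_(x in D) (f x)%:E)%E h => [r||].
Qed.

Lemma normc_cintegral_le {d} {T : measurableType d}
    (mu : {measure set T -> \bar R})
    (D : set T) (f : T -> R[i]) (g : T -> R) (C : R) : measurable D ->
    cmeasurable f -> measurable_fun setT g ->
    (forall x, D x -> normc (f x) <= g x) ->
    (\int[mu]_(x in D) (g x)%:E <= C%:E)%E ->
  normc (cintegral mu D f) <= 2 * C.
Proof.
move=> mD [mf1 mf2] mg fg gC.
have h1 := normr_Rintegral_le mu D _ g C mD mf1 mg
  (fun x Dx => le_trans (normr_Re_le _) (fg x Dx)) gC.
have h2 := normr_Rintegral_le mu D _ g C mD mf2 mg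
  (fun x Dx => le_trans (normr_Im_le _) (fg x Dx)) gC.
have C0 : 0 <= C by exact: le_trans h1.
rewrite -(@ler_pXn2r _ 2) ?nnegrE ?normc_ge0 ?mulr_ge0 // normc_sqr /=.
move: h1 h2; rewrite !ler_norml => /andP[? ?] /andP[? ?]; nra.
Qed.

(** 612 = 2 * 17 * 18: real and imaginary parts, the pointwise bound, and the integral in [t]. *)
Lemma weighted_kernel_primitive_le b (x y : plane R) : 0 <= b ->
    disc x -> disc y ->
  (1 - normc (toC y) ^+ 2) `^ b * normc (kernel_primitive b (toC x) (toC y)) <=
  612 * 2 `^ b * rho_at (toC x) (toC y).
Proof.
move=> b0 dx dy.
have x1 : normc (toC x) < 1 by exact: dx.
have y1 : normc (toC y) < 1 by exact: dy.
set W := _ `^ b; have W0 : 0 < W.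
  by apply: powR_gt0; have := normc_ge0 (toC y); move: (normc _) y1 => n; nra.
set e := 1 - normc (toC x); have e0 : 0 < e by rewrite subr_gt0.
pose A := W^-1 * (2 `^ b * 17 * rho_at (toC x) (toC y)).
have A0 : 0 <= A.
  by rewrite !mulr_ge0 ?invr_ge0 ?(ltW W0) ?powR_ge0 ?rho_ge0.
have hint : (\int[lebesgue_measure]_(t in `[0%R, 1%R]) (A * rho e (t - 1))%:E
    <= (A * 18)%:E)%E.
  under eq_integral do rewrite EFinM.
  rewrite ge0_integralZl_EFin //; first last.
  - by apply/measurable_EFinP; apply: measurable_funTS; exact: measurable_rho.
  - by move=> t _; rewrite lee_fin rho_ge0.
  rewrite (EFinM A 18); apply: lee_wpmul2l; first by rewrite lee_fin.
  apply: le_trans (integral_rho_le e 1 e0 _); last by rewrite normr1; lra.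
  apply: ge0_subset_integral => //.
  - by apply/measurable_EFinP; apply: measurable_funTS; exact: measurable_rho.
  - by move=> t _; rewrite lee_fin rho_ge0.
  - by move=> t /=; rewrite !in_itv /= => /andP[? ->]; rewrite andbT; lra.
have : normc (kernel_primitive b (toC x) (toC y)) <= 2 * (A * 18).
  rewrite /kernel_primitive.
  apply: (@normc_cintegral_le _ (measurableTypeR R) lebesgue_measure _ _
    (fun t => A * rho e (t - 1)) (A * 18)) => //.
  - have := cmeasurable_kernel_integrand b.
    move=> [m1 m2]; split.
      exact: (measurableT_comp m1 (pair1_measurable (x, y))).
    exact: (measurableT_comp m2 (pair1_measurable (x, y))).
  - by apply: measurable_funM; [exact: measurable_cst | exact: measurable_rho].
  - move=> t /=; rewrite in_itv /= => t01.
    have := weighted_integrand_le b t _ _ b0 t01 x1 y1.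
    rewrite -/W -/e mulrC -ler_pdivlMr // => /le_trans; apply.
    by rewrite /A le_eqVlt; apply/orP; left; apply/eqP; field; rewrite gt_eqF.
move=> /(ler_wpM2l (ltW W0)) /le_trans; apply.
by rewrite le_eqVlt; apply/orP; left; apply/eqP; rewrite /A; field; rewrite gt_eqF.
Qed.

(** A product set containing the disc: over it the integral of [rho_at] factors into two integrals,
    each at most 18, whence 324 = 18^2. *)
Definition square : set (plane R) := `[(-1)%R, 1%R]%classic `*` `[(-1)%R, 1%R]%classic.

Lemma disc_sub_square : @disc R `<=` square.
Proof.
move=> x dx; have x1 : normc (toC x) < 1 by exact: dx.
split; rewrite /= in_itv /= -ler_norml; apply: le_trans (ltW x1); first exact: (normr_Re_le (toC x)).
exact: (normr_Im_le (toC x)).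
Qed.

Lemma measurable_square : measurable square.
Proof. by apply: measurableX. Qed.

Let integral_rho_at_le (z : R[i]) : normc z < 1 ->
  (\int[area]_(y in square) (rho_at z (toC y))%:E <= 324%:E)%E.
Proof.
have mS := measurable_square.
move=> z1; set e := 1 - normc z; have e0 : 0 < e by rewrite subr_gt0.
set u := complex.Re (center z); set v := complex.Im (center z).
have hu : `|u| <= 2 := le_trans (normr_Re_le _) (normc_center z).
have hv : `|v| <= 2 := le_trans (normr_Im_le _) (normc_center z).
pose f1 (s : measurableTypeR R) : \bar R :=
  ((fun x => (rho e (x - u))%:E) \_ `[(-1)%R, 1%R]) s.
pose f2 (s : measurableTypeR R) : \bar R :=
  ((fun x => (rho e (x - v))%:E) \_ `[(-1)%R, 1%R]) s.
have mf (c : R) : measurable_fun setT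
    ((fun x : measurableTypeR R => (rho e (x - c))%:E) \_ `[(-1)%R, 1%R]).
  apply/(measurable_restrictT _ _).1 => //; apply: measurable_funTS.
  by apply/measurable_EFinP; exact: measurable_rho.
have f10 s : (0 <= f1 s)%E.
  by rewrite /f1 patchE; case: ifP => // _; rewrite lee_fin rho_ge0.
have f20 s : (0 <= f2 s)%E.
  by rewrite /f2 patchE; case: ifP => // _; rewrite lee_fin rho_ge0.
have if1 : (\int[lebesgue_measure]_s f1 s <= 18%:E)%E.
  by rewrite -integral_mkcond; exact: integral_rho_le.
have if2 : (\int[lebesgue_measure]_s f2 s <= 18%:E)%E.
  by rewrite -integral_mkcond; exact: integral_rho_le.
have mrho : measurable_fun setT (fun y : plane R => rho_at z (toC y)).
  apply: measurable_funM.
    exact: (measurableT_comp (measurable_rho _ _ e0) measurable_fst).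
  exact: (measurableT_comp (measurable_rho _ _ e0) measurable_snd).
rewrite /area ge0_integral_mscale //; first last.
- by move=> y _; rewrite lee_fin mulr_ge0 ?rho_ge0.
- by apply/measurable_EFinP; exact: measurable_funTS.
rewrite integral_mkcond.
have -> : (fun y : plane R => (rho_at z (toC y))%:E) \_ square =
    (fun y => f1 y.1 * f2 y.2)%E.
  apply/funext => -[s t]; rewrite /f1 /f2 !patchE /square in_setX /=.
  by case: (s \in _); case: (t \in _); rewrite /= ?mule0 ?mul0e // -EFinM.
have mff : measurable_fun setT (fun y : plane R => f1 y.1 * f2 y.2)%E.
  apply: emeasurable_funM.
    exact: (measurableT_comp (mf u) measurable_fst).
  exact: (measurableT_comp (mf v) measurable_snd).
rewrite fubini_tonelli1 //=; last by move=> y; exact: mule_ge0.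
rewrite /fubini_F /=.
have inner s : (\int[lebesgue_measure]_t (f1 s * f2 t) =
    f1 s * \int[lebesgue_measure]_t f2 t)%E.
  by rewrite ge0_integralZl //; exact: mf.
under eq_integral do rewrite inner.
rewrite ge0_integralZr //; [|exact: mf|exact: integral_ge0].
have p1 : ((1 / pi)%:E <= 1 :> \bar R)%E.
  by rewrite lee_fin ler_pdivrMr ?pi_gt0 // mul1r; have := @pi_ge2 R; lra.
apply: (@le_trans _ _ (1 * (18%:E * 18%:E))%E); last first.
  by rewrite mul1e -EFinM lee_fin; lra.
apply: lee_pmul => //.
- by rewrite lee_fin divr_ge0 ?pi_ge0.
- by apply: mule_ge0; exact: integral_ge0.
by apply: lee_pmul => //; exact: integral_ge0.
Qed.

Lemma packet_bounded b N (p : cell_index N) : 0 <= b ->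
  exists M, forall x : plane R, disc x -> normc (packet b p (toC x)) <= M.
Proof.
move=> b0; exists (2 * ((b + 1) * (612 * 2 `^ b) * 324)) => x x1.
have mS := measurable_square.
pose A := (b + 1) * (612 * 2 `^ b).
have A0 : 0 <= A by rewrite !mulr_ge0 ?powR_ge0 ?addr_ge0.
have e0 : 0 < 1 - normc (toC x) by rewrite subr_gt0.
have mrho : measurable_fun setT (fun y : plane R => rho_at (toC x) (toC y)).
  apply: measurable_funM.
    exact: (measurableT_comp (measurable_rho _ _ e0) measurable_fst).
  exact: (measurableT_comp (measurable_rho _ _ e0) measurable_snd).
apply: (normc_cintegral_le _ _ _ (fun y => A * rho_at (toC x) (toC y))).
- exact: measurable_cell.
- have [m1 m2] := @cmeasurable_packet_integrand R b; split.
    exact: (measurableT_comp m1 (pair1_measurable x)).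
  exact: (measurableT_comp m2 (pair1_measurable x)).
- by apply: measurable_funM => //; exact: measurable_cst.
- move=> y /cell_sub_disc y1.
  have := weighted_kernel_primitive_le b x y b0 x1 y1.
  rewrite normcM normc_real normrM !ger0_norm ?powR_ge0 ?addr_ge0 // => h.
  by rewrite mulrC -mulrA /A -(mulrA (b + 1)); apply: ler_wpM2l; rewrite ?addr_ge0.
under eq_integral do rewrite EFinM.
rewrite ge0_integralZl_EFin //; first last.
- by apply/measurable_EFinP; exact: measurable_funTS.
- by move=> y _; rewrite lee_fin mulr_ge0 ?rho_ge0.
- exact: measurable_cell.
rewrite (EFinM A 324); apply: lee_wpmul2l; first by rewrite lee_fin.
apply: le_trans (integral_rho_at_le (toC x) x1).
apply: ge0_subset_integral => //.
- exact: measurable_cell.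
- by apply/measurable_EFinP; exact: measurable_funTS.
- by move=> y _; rewrite lee_fin mulr_ge0 ?rho_ge0.
- by move=> y /cell_sub_disc/disc_sub_square.
Qed.

End PacketBound.

(** * Cell masses and Gram forms *)

Section NonmeasurableDomain.
Context {R : realType} {d} {T : measurableType d} (mu : {measure set T -> \bar R}).

(* The integral of a nonnegative function is a supremum over simple functions
   below it, so it is monotone even without measurability; this spares proving
   that Carleson boxes are measurable. *)
Lemma ge0_le_integral_dom (D E : set T) (f g : T -> \bar R) : D `<=` E ->
    (forall x, D x -> 0 <= f x)%E -> (forall x, E x -> 0 <= g x)%E ->
    (forall x, D x -> f x <= g x)%E ->
  (\int[mu]_(x in D) f x <= \int[mu]_(x in E) g x)%E.
Proof.
move=> DE f0 g0 fg; rewrite !ge0_integralE //.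
apply: ereal_sup_le => _ [h hf <-]; exists h => //= x.
apply: le_trans (hf x) _; rewrite !patchE.
case: ifPn => [|_]; first by rewrite inE => Dx; rewrite mem_set ?fg //; exact: DE.
by case: ifPn => // /set_mem; exact: g0.
Qed.

End NonmeasurableDomain.

Section CellMass.
Context {R : realType} (K : R -> R) (hK : weight_class K) (N : nat).
Implicit Types (I : circle_arc R) (p : cell_index N).

Lemma carleson_box_ratio I (x : plane R) : carleson_box I x ->
  0 <= (1 - normc (toC x)) / arc_len I <= 1.
Proof.
move=> [r [t [_ /andP[r1 r2] ->]]]; have l0 := arc_len_gt0 I.
have l1 := arc_len_le1 I.
rewrite normc_polar; last lra.
by rewrite ler_pdivrMr // divr_ge0 ?(ltW l0) //; lra.
Qed.

Definition mass_bound : R := K 1 * fine (@area R disc).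

Lemma area_disc_fin : (@area R disc < +oo)%E.
Proof.
apply: le_lt_trans (le_measure _ _ _ (@disc_sub_square R)) _; rewrite ?inE.
- exact: measurable_disc.
- exact: measurable_square.
rewrite /area /= /mscale /= product_measure1E //.
apply: lte_mul_pinfty => //; first by rewrite lee_fin divr_ge0 ?pi_ge0.
have L : ((@lebesgue_measure R) `[(-1)%R, 1%R]%classic < +oo)%E.
  by rewrite lebesgue_measure_itv /=; case: ifP => _; rewrite ?ltry.
by apply: lte_mul_pinfty => //; rewrite ge0_fin_numE.
Qed.

Lemma cell_mass_bound I p : (0 <= cell_mass K I p <= mass_bound%:E)%E.
Proof.
have K1 : 0 <= K 1 by exact: (weight_nneg hK).
have f0 x : (cell p `&` carleson_box I) x ->
    (0 <= (K ((1 - normc (toC x)) / arc_len I))%:E)%E.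
  by move=> [_ /carleson_box_ratio/andP[h _]]; rewrite lee_fin; exact: (weight_nneg hK).
apply/andP; split; first exact: integral_ge0.
have -> : mass_bound%:E = (\int[area]_(x in @disc R) (K 1)%:E)%E.
  rewrite integral_cst; last exact: measurable_disc.
  by rewrite EFinM fineK // ge0_fin_numE // area_disc_fin.
apply: ge0_le_integral_dom => //; first by move=> x [/cell_sub_disc].
move=> x [_ /carleson_box_ratio/andP[h h1]]; rewrite lee_fin.
exact: (weight_nondecreasing hK).
Qed.

Definition arc_mass I p : R := fine (cell_mass K I p).

Lemma arc_massE I p : (arc_mass I p)%:E = cell_mass K I p.
Proof.
have /andP[h0 h1] := cell_mass_bound I p.
by rewrite fineK // ge0_fin_numE // (le_lt_trans h1) // ltry.
Qed.

Lemma arc_mass_bound I p : 0 <= arc_mass I p <= mass_bound.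
Proof. by rewrite -!lee_fin arc_massE; exact: cell_mass_bound. Qed.

Lemma discrete_norm_le1 (c : cell_index N -> R[i]) :
  (discrete_norm K c <= 1)%E <-> feasible arc_mass (fun p => normc (c p) ^+ 2).
Proof.
pose F I := (\sum_(p : cell_index N) (normc (c p) ^+ 2)%:E * cell_mass K I p)%E.
have FE I : F I = (\sum_p normc (c p) ^+ 2 * arc_mass I p)%:E.
  by rewrite -sumEFin; apply: eq_bigr => p _; rewrite -arc_massE -EFinM.
have supP : (ereal_sup (range F) <= 1)%E <->
    feasible arc_mass (fun p => normc (c p) ^+ 2).
  split=> [h I|h].
    by rewrite -lee_fin -FE; apply: le_trans h; apply: ereal_sup_ubound; exists I.
  by apply: ge_ereal_sup => _ [I _ <-]; rewrite FE lee_fin.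
rewrite -supP /discrete_norm -/F; case: (ereal_sup _) => [r||] //=; last by rewrite lee01 leNye.
rewrite !lee_fin; split=> h; last by rewrite -sqrtr1 ler_wsqrtr.
have [r0|/ltW r0] := leP r 0; first by rewrite (le_trans r0).
by rewrite -(sqr_sqrtr r0) expr_le1 ?sqrtr_ge0.
Qed.

End CellMass.

Section GramForm.
Context {R : realType} {d} {T : measurableType d}
  (mu : {finite_measure set T -> \bar R}) (D : set T) {P : finType}
  (psi : P -> T -> R[i]).
Hypothesis mD : measurable D.
Hypothesis mpsi : forall p, cmeasurable (psi p).
Hypothesis psi_bounded : forall p, exists M, forall x, D x -> normc (psi p x) <= M.

Definition gram (p q : P) : R[i] :=
  cintegral mu D (fun x => psi p x * (psi q x)^*).

Let bounded_integrable (f : T -> R) (M : R) : measurable_fun setT f ->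
  (forall x, D x -> `|f x| <= M) -> mu.-integrable D (EFin \o f).
Proof.
move=> mf fM; apply: measurable_bounded_integrable => //.
- by rewrite -ge0_fin_numE // fin_num_measure.
- exact: measurable_funTS.
exists M; split; first exact: num_real.
by move=> x Mx y Dy; exact: le_trans (fM y Dy) (ltW Mx).
Qed.

Let re p q x : R := complex.Re (psi p x * (psi q x)^*).
Let im p q x : R := complex.Im (psi p x * (psi q x)^*).

Let integrable_re_im p q :
  mu.-integrable D (EFin \o re p q) /\ mu.-integrable D (EFin \o im p q).
Proof.
have [m1 m2] := cmeasurableM _ _ (mpsi p) (cmeasurable_conj _ (mpsi q)).
have [M1 hM1] := psi_bounded p; have [M2 hM2] := psi_bounded q.
have hM x : D x -> normc (psi p x * (psi q x)^*) <= M1 * M2.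
  move=> dx; rewrite normcM normc_conj.
  by apply: ler_pM; rewrite ?normc_ge0 ?hM1 ?hM2.
split; apply: (bounded_integrable _ (M1 * M2)) => // x dx.
  exact: le_trans (normr_Re_le _) (hM x dx).
exact: le_trans (normr_Im_le _) (hM x dx).
Qed.

Let gramE p q : gram p q = Rintegral mu D (re p q) +i* Rintegral mu D (im p q).
Proof. by []. Qed.

Lemma gram_sym p q : gram q p = (gram p q)^*.
Proof.
rewrite !gramE; have -> : re q p = re p q.
  apply/funext => x; rewrite /re.
  by case: (psi p x) (psi q x) => [a1 a2] [b1 b2] /=; ring.
have -> : im q p = (fun x => -1 * im p q x).
  apply/funext => x; rewrite /im.
  by case: (psi p x) (psi q x) => [a1 a2] [b1 b2] /=; ring.
rewrite RintegralZl //; last by case: (integrable_re_im p q).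
by rewrite mulN1r.
Qed.

(** Expand the square and integrate termwise. Boundedness of [psi] on [D] and finiteness of [mu]
    make every cross term integrable; otherwise the entries of [gram] could be default values. *)
Lemma gram_formE (v : P -> R[i]) : (hermitian_form gram v)%:E =
  (\int[mu]_(x in D) (normc (\sum_p v p * psi p x) ^+ 2)%:E)%E.
Proof.
pose f p q x : R := complex.Re (v p * (v q)^*) * re p q x
  - complex.Im (v p * (v q)^*) * im p q x.
have intf1 p q : mu.-integrable D (EFin \o
    (fun x => complex.Re (v p * (v q)^*) * re p q x)).
  by have [i1 i2] := integrable_re_im p q; exact: (integrableZl mD _ i1).
have intf2 p q : mu.-integrable D (EFin \o
    (fun x => complex.Im (v p * (v q)^*) * im p q x)).
  by have [i1 i2] := integrable_re_im p q; exact: (integrableZl mD _ i2).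
have intf p q : mu.-integrable D (EFin \o f p q).
  exact: (integrableB mD (intf1 p q) (intf2 p q)).
have -> : (hermitian_form gram v)%:E =
    (\sum_p \sum_q \int[mu]_(x in D) (f p q x)%:E)%E.
  rewrite /hermitian_form -sumEFin; apply: eq_bigr => p _; rewrite -sumEFin.
  apply: eq_bigr => q _; have [i1 i2] := integrable_re_im p q.
  have -> : (\int[mu]_(x in D) (f p q x)%:E)%E = (Rintegral mu D (f p q))%:E.
    by rewrite fineK //; exact: (integrable_fin_num mD (intf p q)).
  congr (_%:E); rewrite /f RintegralB // !RintegralZl // gramE.
  by case: (v p * _) => a1 a2.
under eq_bigr => p _.
  rewrite -(integral_sum mD) /=; last by move=> q; exact: intf.
  over.
rewrite -(integral_sum mD) /=; last first.
  by move=> p; apply: (integrable_sum mD) => q _; exact: intf.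
apply: eq_integral => x _; under eq_bigr do rewrite sumEFin.
rewrite sumEFin; congr (_%:E).
have -> z : normc z ^+ 2 = complex.Re (z * z^*) :> R.
  by rewrite normc_sqr; case: z => a1 a2 /=; ring.
rewrite rmorph_sum mulr_suml Re_sum; apply: eq_bigr => p _.
rewrite mulr_sumr Re_sum; apply: eq_bigr => q _.
rewrite /f /re /im.
by case: (v p) (v q) (psi p x) (psi q x) =>
  [a1 a2] [b1 b2] [c1 c2] [d1 d2] /=; ring.
Qed.

Lemma gram_form_ge0 v : 0 <= hermitian_form gram v.
Proof.
rewrite -lee_fin gram_formE; apply: integral_ge0 => x _.
by rewrite lee_fin sqr_ge0.
Qed.

End GramForm.

(** * The capacities *)

Section Capacities.
Context {R : realType} (K : R -> R) (hK : weight_class K) (b : R) (b0 : 0 <= b).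
Variable mu : {finite_measure set (plane R) -> \bar R}.

Let psi N (p : cell_index N) (x : plane R) : R[i] := packet b p (toC x).

Let psi_measurable N p : cmeasurable (psi N p).
Proof. exact: cmeasurable_packet. Qed.

Let psi_bounded N p : exists M, forall x, disc x -> normc (psi N p x) <= M.
Proof. exact: packet_bounded. Qed.

Let G N := gram mu disc (psi N).

Let energy N (c : cell_index N -> R[i]) : \bar R :=
  (\int[mu]_(x in disc)
    (normc (\sum_(p : cell_index N) c p * packet b p (toC x)) ^+ 2)%:E)%E.

Let energyE N c : energy N c = (hermitian_form (G N) c)%:E.
Proof.
exact/esym/(gram_formE _ _ _ measurable_disc (psi_measurable N) (psi_bounded N)).
Qed.

Let G_sym N p q : G N q p = (G N p q)^*.
Proof.
exact: (gram_sym _ _ _ measurable_disc (psi_measurable N) (psi_bounded N)).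
Qed.

Let G_ge0 N v : 0 <= hermitian_form (G N) v.
Proof.
exact: (gram_form_ge0 _ _ _ measurable_disc (psi_measurable N) (psi_bounded N)).
Qed.

Lemma dominating_sumP N s : dominating_sum K b mu N s <->
  exists M (lam : 'I_M -> R) (I : 'I_M -> circle_arc R),
    [/\ forall m, 0 <= lam m,
        forall v, hermitian_form (G N) v <=
          \sum_p (\sum_m lam m * arc_mass K N (I m) p) * normc (v p) ^+ 2 &
        s = \sum_m lam m].
Proof.
have diagE I : diag_matrix K I N = weight_mx (arc_mass K N I) by [].
have packetE : packet_matrix b mu N = gram_mx (G N) by [].
split=> -[M [lam [I [lam0 h sE]]]]; exists M, lam, I; split=> //.
  apply/loewner_le_weight; first exact: G_sym.
  rewrite -sum_weight_mx -packetE; move: h; congr loewner_le.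
rewrite packetE.
have -> : \sum_(m < M) (lam m)%:C *: diag_matrix K (I m) N =
    weight_mx (fun p => \sum_m lam m * arc_mass K N (I m) p).
  by rewrite -sum_weight_mx.
by apply/loewner_le_weight => //; exact: G_sym.
Qed.

Lemma energy_le_dominating N c s : (discrete_norm K c <= 1)%E ->
  dominating_sum K b mu N s -> (energy N c <= s%:E)%E.
Proof.
move=> /(discrete_norm_le1 K hK N) fc /dominating_sumP[M [lam [I [lam0 h ->]]]].
rewrite energyE lee_fin; apply: le_trans (h c) _.
have -> : \sum_p (\sum_m lam m * arc_mass K N (I m) p) * normc (c p) ^+ 2 =
    \sum_m lam m * \sum_p normc (c p) ^+ 2 * arc_mass K N (I m) p.
  under eq_bigr do rewrite mulr_suml.
  rewrite exchange_big; apply: eq_bigr => m _; rewrite mulr_sumr.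
  by apply: eq_bigr => p _; rewrite -mulrA [_ * arc_mass _ _ _ _]mulrC.
apply: ler_sum => m _; rewrite -[leRHS]mulr1.
by apply: ler_wpM2l => //; exact: fc.
Qed.

Lemma capacityC_le_capacityD : (capacityC K b mu <= capacityD K b mu)%E.
Proof.
apply: ge_ereal_sup => _ [N _ <-]; apply: ge_ereal_sup => _ [c hc <-].
apply: (@le_trans _ _ (ereal_inf [set s%:E | s in dominating_sum K b mu N])).
  apply: le_ereal_inf_tmp => _ [s hs <-].
  exact: (energy_le_dominating N c s hc hs).
by apply: ereal_sup_ubound; exists N.
Qed.

Lemma capacityC_ge0 : (0 <= capacityC K b mu)%E.
Proof.
have f0 : (discrete_norm K (fun _ : cell_index 0 => 0%R : R[i]) <= 1)%E.
  apply/(discrete_norm_le1 K hK 0) => I.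
  by rewrite big1 // => p _; rewrite normc0 expr0n mul0r.
apply: (@le_trans _ _ (energy 0 (fun=> 0%R))).
  by rewrite energyE lee_fin G_ge0.
apply: le_trans (ereal_sup_ubound _); last by exists 0.
by apply: ereal_sup_ubound; exists (fun=> 0%R).
Qed.

Lemma exists_dominating_sum N (gam : R) : 0 < gam ->
    (capacityC K b mu <= gam%:E)%E ->
  dominating_sum K b mu N (24 * gam).
Proof.
move=> gam0 hgam.
have form_le v : feasible (arc_mass K N) (fun p => normc (v p) ^+ 2) ->
    hermitian_form (G N) v <= gam.
  move=> /(discrete_norm_le1 K hK N) hv; rewrite -lee_fin -energyE.
  apply: le_trans hgam; apply: le_trans (ereal_sup_ubound _); last by exists N.
  by apply: ereal_sup_ubound; exists v.
pose I0 := Arc 0 true true (@ltr01 R) (lexx 1).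
have [l [l0 lE hl]] := dominating_mixture I0 _ _ (G N) gam
  (arc_mass_bound K hK N) (G_sym N) (G_ge0 N) gam0 form_le.
apply/dominating_sumP.
exists (size l), (fun m => (tnth (in_tuple l) m).1),
  (fun m => (tnth (in_tuple l) m).2).
split.
- by move=> m; move/all_tnthP: (l0 : all _ (in_tuple l)); exact.
- move=> v; apply: le_trans (hl v) _; rewrite le_eqVlt; apply/orP; left.
  by apply/eqP; apply: eq_bigr => p _; rewrite /mixture big_tnth.
- by rewrite -lE /total_weight big_tnth.
Qed.

Lemma capacityD_le_capacityC : (capacityD K b mu <= 24%:E * capacityC K b mu)%E.
Proof.
have := capacityC_ge0; case E : (capacityC K b mu) => [g||] //; last first.
  by move=> _; rewrite mulry gtr0_sg // mul1e leey.
rewrite lee_fin => g0; apply: ge_ereal_sup => _ [N _ <-].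
(* The domination lemma needs a positive level, and the capacity may be 0. *)
apply/lee_addgt0Pr => e e0.
have ge0 : 0 < g + e / 24 by rewrite ltr_wpDl // divr_gt0.
apply: ereal_inf_lbound; exists (24 * (g + e / 24)); last first.
  by rewrite -EFinM -EFinD; congr (_%:E); field.
apply: exists_dominating_sum => //.
by rewrite E lee_fin lerDl divr_ge0 // ltW.
Qed.

End Capacities.

Theorem theorem5p3 (R : realType) (K : R -> R) (hK : weight_class K) :
  exists b0 : R, forall b : R, b0 <= b ->
    exists2 C : R, 0 < C &
      forall mu : {finite_measure set (plane R) -> \bar R},
        mu (~` disc) = 0%E ->
        (capacityC K b mu <= C%:E * capacityD K b mu)%E /\
        (capacityD K b mu <= C%:E * capacityC K b mu)%E.
Proof.
(* The threshold 0 is the one under which the weight absorbs the power [b] of the kernel. *)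
exists 0 => b b0; exists 24 => // mu _; split; last exact: capacityD_le_capacityC.
have CD := capacityC_le_capacityD K hK b b0 mu.
have D0 := le_trans (capacityC_ge0 K hK b b0 mu) CD.
apply: (le_trans CD).
by rewrite -[leLHS]mul1e; apply: lee_wpmul2r => //; rewrite lee_fin ler1n.
Qed.
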